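(* Let $\mathcal{F}$ be the set of all nonnegative real functions $f$ with $\int f(x)\,dx=1$, supported on the interval $[-\frac14,\frac14]$, and let $$S=\inf_{f\in\mathcal{F}}\|f\ast f\|_\infty.$$ Then $$1.2748\le S\le 1.5098.$$
   Context: The autoconvolution of $f$ is $f\ast f(x)=\int f(t)f(x-t)\,dt$, and $\|f\ast f\|_\infty$ denotes its supremum. *)

(* Defs.v *)
From mathcomp Require Import all_boot all_order all_algebra.
From mathcomp Require Import all_classical all_reals all_analysis.
Set Implicit Arguments.
Unset Strict Implicit.
Unset Printing Implicit Defensive.
Import Order.TTheory GRing.Theory Num.Theory.
Import numFieldNormedType.Exports.
Local Open Scope classical_set_scope.
Local Open Scope ring_scope.

(* The real line with the sigma-algebra of all Lebesgue measurable sets, not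
   only the Borel ones; it is the domain of [completed_lebesgue_measure]. *)
Notation lebesgueTypeR R := (caratheodory_type (@wlength R idfun)^*%mu).

(* Extended-real valued: for nonnegative measurable f the integral exists in
   [0, +oo] at every x, but it may be +oo. *)
Definition autoconv (R : realType) (f : R -> R) (x : R) : \bar R :=
  (\int[@completed_lebesgue_measure R]_t (f t * f (x - t))%:E)%E.

Definition sup_autoconv (R : realType) (f : R -> R) : \bar R :=
  ereal_sup (range (autoconv f)).

Definition admissible (R : realType) : set (R -> R) :=
  [set f : R -> R |
    [/\ measurable_fun [set: lebesgueTypeR R] f,
        forall x, 0 <= f x,
        [set x | f x != 0] `<=` `[- (1 / 4), 1 / 4] &
        (\int[@completed_lebesgue_measure R]_x (f x)%:E = 1)%E]].

Definition inf_sup_autoconv (R : realType) : \bar R :=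
  ereal_inf [set sup_autoconv f | f in @admissible R].

(* Main.v *)
Require Import Defs.
From mathcomp Require Import all_boot all_order all_algebra.
From mathcomp Require Import all_classical all_reals all_analysis.
From mathcomp Require Import measurable_realfun ring lra zify.
From Stdlib Require BinNat Nnat.
Import Order.TTheory GRing.Theory Num.Theory.
Import numFieldNormedType.Exports.
Local Open Scope classical_set_scope.
Local Open Scope ring_scope.

(** Lower bound. Let [g = f * f <= M] and let [c] be the autocorrelation of [f]. Fix a step function
    [e] with autocorrelation [K], put [A = int e], and let [U], [V] be the convolution and the
    correlation of [f] with [e]. Then [int (U + V)^2 = 2 (int c K + int g K)]. Testing [U + V]
    against a second step function [w], whose correlation with [e] is at least [T] on [-1/4, 1/4],
    bounds this from below by a multiple of [T^2 / int w^2]. From above, [int g K <= M A^2], and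
    since [int c^2 = int g^2 <= M] and [c] lives on [-1/2, 1/2], Cauchy-Schwarz for [c] and [K + b]
    controls [int c K]. For suitable [e], [w], [b] the two bounds force [M >= 1.2748].

    Upper bound. An explicit step function with 240 steps.

    All functions are step functions or piecewise linear on a grid of mesh 1/480, so every numerical
    condition is a statement on integer convolutions. The lists of heights come from a numerical
    optimisation. *)

Local Notation N := BinNums.N.

(** * Correlation and convolution *)

Section translation.
Context {R : realType}.
Local Notation mu := (@lebesgue_measure R).
Local Open Scope ereal_scope.
Implicit Types (k : R -> \bar R) (a : R).

Lemma measurable_shift a : measurable_fun [set: R] (fun x : R => x + a)%R.
Proof. exact: measurable_realfun.measurable_funD. Qed.

(** Half-open intervals determine Lebesgue measure, and a translation preserves their length. *)
Lemma lebesgue_measure_shift a (A : set R) : measurable A ->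
  pushforward mu ((fun x => x + a)%R : _ -> measurableTypeR R) A = mu A.
Proof.
move=> mA; have ms := measurable_shift a.
apply/esym; apply: (@lebesgue_measure_unique R (pushforward mu _)) => //.
move=> _ [[x y]] _ <-; rewrite /pushforward.
rewrite [X in _ = mu X](_ : _ = `]x - a, y - a]%classic)%R; last first.
  by apply/seteqP; split => z /=; rewrite !in_itv/= ltrBlDr lerBrDr.
by rewrite !lebesgue_measure_itv/= !lte_fin ltrD2r -!EFinB opprD opprK addrACA addNr addr0.
Qed.

Lemma ge0_integral_shift k a : measurable_fun [set: R] k -> (forall x, 0 <= k x) ->
  \int[mu]_x k (x + a)%R = \int[mu]_x k x.
Proof.
move=> mk k0; have ms := measurable_shift a.
transitivity (\int[pushforward mu ((fun x => x + a)%R : _ -> measurableTypeR R)]_x k x).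
  by rewrite ge0_integral_pushforward.
by apply: eq_measure_integral => A mA _; exact: lebesgue_measure_shift.
Qed.

End translation.

Section correlation.
Context {R : realType}.
Local Notation mu := (@lebesgue_measure R).
Local Open Scope ereal_scope.
Implicit Types (a b f k : R -> \bar R) (F G : R * R -> \bar R).

Lemma measurable_integral_snd F : measurable_fun [set: R * R] F ->
  (forall z, 0 <= F z) -> measurable_fun [set: R] (fun x => \int[mu]_y F (x, y)).
Proof. by move=> mF F0; exact: (measurable_fun_fubini_tonelli_F (m2 := mu) F). Qed.

Lemma integral_swap F : measurable_fun [set: R * R] F -> (forall z, 0 <= F z) ->
  \int[mu]_x \int[mu]_y F (x, y) = \int[mu]_y \int[mu]_x F (x, y).
Proof. by move=> mF F0; rewrite (fubini_tonelli (m1 := mu) (m2 := mu) F). Qed.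

(** Extended-real values: for nonnegative measurable functions Tonelli applies with no integrability
    condition. *)
Definition corr a b (x : R) : \bar R := \int[mu]_t (a t * b (t + x)%R).

Definition convo a b (x : R) : \bar R := \int[mu]_t (a t * b (x - t)%R).

Lemma measurable_comp_add d (T : measurableType d) k (u v : T -> R) :
  measurable_fun [set: R] k -> measurable_fun [set: T] u -> measurable_fun [set: T] v ->
  measurable_fun [set: T] (fun z => k (u z + v z)%R).
Proof. by move=> mk mu_ mv; apply: measurableT_comp => //; exact: measurable_funD. Qed.

Lemma measurable_comp_sub d (T : measurableType d) k (u v : T -> R) :
  measurable_fun [set: R] k -> measurable_fun [set: T] u -> measurable_fun [set: T] v ->
  measurable_fun [set: T] (fun z => k (u z - v z)%R).
Proof. by move=> mk mu_ mv; apply: measurableT_comp => //; exact: measurable_funB. Qed.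

Lemma corr_ge0 a b x : (forall x, 0 <= a x) -> (forall x, 0 <= b x) -> 0 <= corr a b x.
Proof. by move=> a0 b0; apply: integral_ge0 => t _; exact: mule_ge0. Qed.

Lemma convo_ge0 a b x : (forall x, 0 <= a x) -> (forall x, 0 <= b x) -> 0 <= convo a b x.
Proof. by move=> a0 b0; apply: integral_ge0 => t _; exact: mule_ge0. Qed.

Lemma measurable_corr a b : measurable_fun [set: R] a -> measurable_fun [set: R] b ->
  (forall x, 0 <= a x) -> (forall x, 0 <= b x) -> measurable_fun [set: R] (corr a b).
Proof.
move=> ma mb a0 b0.
apply: (@measurable_integral_snd (fun z => a z.2 * b (z.2 + z.1)%R)).
- apply: emeasurable_funM; first exact: measurableT_comp.
  exact: measurable_comp_add.
- by move=> z; exact: mule_ge0.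
Qed.

Lemma measurable_convo a b : measurable_fun [set: R] a -> measurable_fun [set: R] b ->
  (forall x, 0 <= a x) -> (forall x, 0 <= b x) -> measurable_fun [set: R] (convo a b).
Proof.
move=> ma mb a0 b0.
apply: (@measurable_integral_snd (fun z => a z.2 * b (z.1 - z.2)%R)).
- apply: emeasurable_funM; first exact: measurableT_comp.
  exact: measurable_comp_sub.
- by move=> z; exact: mule_ge0.
Qed.

Section three_functions.
Variables a b k : R -> \bar R.
Hypotheses (ma : measurable_fun [set: R] a) (mb : measurable_fun [set: R] b)
  (mk : measurable_fun [set: R] k).
Hypotheses (a0 : forall x, 0 <= a x) (b0 : forall x, 0 <= b x) (k0 : forall x, 0 <= k x).

(** The substitution [s = t + x] and Tonelli: [corr a b] is the density of the difference [s - t]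
    under the weight [a t * b s]. *)
Lemma integral_corrM :
  \int[mu]_t \int[mu]_s (a t * b s * k (s - t)%R) = \int[mu]_x (corr a b x * k x).
Proof.
transitivity (\int[mu]_t \int[mu]_x (a t * b (t + x)%R * k x)).
  apply: eq_integral => t _.
  rewrite -(@ge0_integral_shift _ (fun s => a t * b s * k (s - t)%R) t); first last.
  - by move=> s; rewrite !mule_ge0.
  - apply: emeasurable_funM; last exact: measurable_comp_sub.
    exact: emeasurable_funM.
  by apply: eq_integral => x _; rewrite addrK (addrC x).
rewrite (integral_swap (fun z => a z.1 * b (z.1 + z.2)%R * k z.2)); first last.
- by move=> z; rewrite !mule_ge0.
- apply: emeasurable_funM; last exact: measurableT_comp.
  apply: emeasurable_funM; first exact: measurableT_comp.
  exact: measurable_comp_add.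
apply: eq_integral => x _ /=; rewrite /corr ge0_integralZr //.
- by apply: emeasurable_funM => //; exact: measurable_comp_add.
- by move=> t _; rewrite mule_ge0.
Qed.

(** The same with [s = x - t]: [convo a b] is the density of the sum [t + s]. *)
Lemma integral_convoM :
  \int[mu]_t \int[mu]_s (a t * b s * k (t + s)%R) = \int[mu]_x (convo a b x * k x).
Proof.
transitivity (\int[mu]_t \int[mu]_x (a t * b (x - t)%R * k x)).
  apply: eq_integral => t _.
  rewrite -(@ge0_integral_shift _ (fun x => a t * b (x - t)%R * k x) t); first last.
  - by move=> s; rewrite !mule_ge0.
  - apply: emeasurable_funM => //; apply: emeasurable_funM => //.
    exact: measurable_comp_sub.
  by apply: eq_integral => x _; rewrite addrK (addrC x).
rewrite (integral_swap (fun z => a z.1 * b (z.2 - z.1)%R * k z.2)); first last.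
- by move=> z; rewrite !mule_ge0.
- apply: emeasurable_funM; last exact: measurableT_comp.
  apply: emeasurable_funM; first exact: measurableT_comp.
  exact: measurable_comp_sub.
apply: eq_integral => x _ /=; rewrite /convo ge0_integralZr //.
- by apply: emeasurable_funM => //; exact: measurable_comp_sub.
- by move=> t _; rewrite mule_ge0.
Qed.

End three_functions.

(** Tonelli in [y], [t], [s]. With [F] and [G] translates of [e], the inner integral over [y]
    becomes a value of the autocorrelation of [e]. *)
Lemma integral_prod_integral a b F G :
  measurable_fun [set: R] a -> measurable_fun [set: R] b ->
  measurable_fun [set: R * R] F -> measurable_fun [set: R * R] G ->
  (forall x, 0 <= a x) -> (forall x, 0 <= b x) ->
  (forall z, 0 <= F z) -> (forall z, 0 <= G z) ->
  \int[mu]_y ((\int[mu]_t (a t * F (t, y))) * (\int[mu]_s (b s * G (s, y)))) =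
  \int[mu]_t \int[mu]_s (a t * b s * \int[mu]_y (F (t, y) * G (s, y))).
Proof.
move=> ma mb mF mG a0 b0 F0 G0.
have mFy y : measurable_fun [set: R] (fun t => F (t, y)).
  by apply: measurableT_comp => //; exact: measurable_pair2.
have mGy y : measurable_fun [set: R] (fun t => G (t, y)).
  by apply: measurableT_comp => //; exact: measurable_pair2.
have mFt t : measurable_fun [set: R] (fun y => F (t, y)).
  by apply: measurableT_comp => //; exact: measurable_pair1.
have mGt t : measurable_fun [set: R] (fun y => G (t, y)).
  by apply: measurableT_comp => //; exact: measurable_pair1.
pose IG y := \int[mu]_s (b s * G (s, y)).
have mIG : measurable_fun [set: R] IG.
  apply: (@measurable_integral_snd (fun z => b z.2 * G (z.2, z.1))).
    apply: emeasurable_funM; first exact: measurableT_comp.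
    by apply: measurableT_comp => //; exact: measurable_swap.
  by move=> z; rewrite mule_ge0.
have IG0 y : 0 <= IG y by apply: integral_ge0 => s _; rewrite mule_ge0.
transitivity (\int[mu]_y \int[mu]_t (a t * F (t, y) * IG y)).
  apply: eq_integral => y _; rewrite ge0_integralZr //.
  - by apply: emeasurable_funM => //; exact: mFy.
  - by move=> t _; rewrite mule_ge0.
rewrite -(integral_swap (fun z => a z.1 * F z * IG z.2)); first last.
- by move=> z; rewrite !mule_ge0.
- apply: emeasurable_funM; last exact: measurableT_comp.
  by apply: emeasurable_funM => //; exact: measurableT_comp.
apply: eq_integral => t _ /=.
transitivity (\int[mu]_y \int[mu]_s (a t * b s * (F (t, y) * G (s, y)))).
  apply: eq_integral => y _; rewrite /IG -ge0_integralZl //.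
  - by apply: eq_integral => s _; rewrite muleACA.
  - by apply: emeasurable_funM => //; exact: mGy.
  - by move=> s _; rewrite mule_ge0.
  - by rewrite mule_ge0.
rewrite -(integral_swap (fun z => a t * b z.1 * (F (t, z.2) * G z))); first last.
- by move=> z; rewrite !mule_ge0.
- apply: emeasurable_funM.
    by apply: emeasurable_funM => //; exact: measurableT_comp.
  apply: emeasurable_funM => //.
  exact: (measurableT_comp (mFt t)).
apply: eq_integral => s _ /=; rewrite ge0_integralZl //.
- by apply: emeasurable_funM; [exact: mFt|exact: mGt].
- by move=> y _; rewrite mule_ge0.
- by rewrite mule_ge0.
Qed.

End correlation.

(** * Autocorrelation and autoconvolution have the same square integral *)

Section autocorrelation.
Context {R : realType}.
Local Notation mu := (@lebesgue_measure R).
Local Open Scope ereal_scope.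

(* Both sides integrate [f a * f b * f c * f d] over [a + b = c + d]. *)
Lemma integral_sqr_corr_convo (f : R -> \bar R) :
  measurable_fun [set: R] f -> (forall x, 0 <= f x) ->
  \int[mu]_x (corr f f x * corr f f x) = \int[mu]_x (convo f f x * convo f f x).
Proof.
move=> mf f0.
have mc := measurable_corr _ _ mf mf f0 f0; have mg := measurable_convo _ _ mf mf f0 f0.
have c0 x : 0 <= corr f f x by exact: corr_ge0.
have g0 x : 0 <= convo f f x by exact: convo_ge0.
rewrite -(integral_corrM _ _ _ mf mf mc f0 f0 c0) -(integral_convoM _ _ _ mf mf mg f0 f0 g0).
pose H (t s a : R) := f t * f s * (f a * f (t + s - a)%R).
have H0 t s a : 0 <= H t s a by rewrite !mule_ge0.
have mH : measurable_fun [set: R * R * R] (fun z => H z.1.1 z.2 z.1.2).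
  apply: emeasurable_funM; last first.
    apply: emeasurable_funM; first by do 2 apply: measurableT_comp => //.
    apply: measurable_comp_sub => //; last exact: measurableT_comp.
    by apply: measurable_funD => //; exact: measurableT_comp.
  by apply: emeasurable_funM; apply: measurableT_comp => //; exact: measurableT_comp.
transitivity (\int[mu]_a \int[mu]_t \int[mu]_s H t s a); last first.
  rewrite -(integral_swap (fun z => \int[mu]_s H z.1 s z.2)); first last.
  - by move=> z; exact: integral_ge0.
  - exact: (measurable_fun_fubini_tonelli_F (m2 := mu) (fun z => H z.1.1 z.2 z.1.2)).
  apply: eq_integral => t _.
  rewrite -(integral_swap (fun z => H t z.1 z.2)) //; last first.
    apply: emeasurable_funM; last first.
      apply: emeasurable_funM; first exact: measurableT_comp.
      by apply: measurable_comp_sub => //; exact: measurable_funD.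
    by apply: emeasurable_funM => //; exact: measurableT_comp.
  apply: eq_integral => s _; rewrite /convo -ge0_integralZl ?mule_ge0//.
    by apply: emeasurable_funM => //; exact: measurable_comp_sub.
  by move=> a _; rewrite mule_ge0.
(* The names rotate: [t], [s] and the inner variable [a] of [corr] play the roles of [a], [t], [s]
   in [H]. *)
apply: eq_integral => t _; apply: eq_integral => s _.
rewrite /corr -ge0_integralZl ?mule_ge0//.
- apply: eq_integral => a _; rewrite /H addrA (addrC a).
  by rewrite (muleC (f t)) -!muleA; congr (_ * _); rewrite muleCA.
- by apply: emeasurable_funM => //; exact: measurable_comp_add.
- by move=> a _; rewrite mule_ge0.
Qed.

(** [(th * x - y)^2 >= 0], extended to infinite values. Integrated, it replaces Cauchy-Schwarz: the
    free parameter [th] avoids square roots and tolerates infinite integrals. *)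
Lemma mule_AMGM (x y : \bar R) (th : R) : (0 < th)%R -> 0 <= x -> 0 <= y ->
  (2 * th)%:E * (x * y) <= (th ^+ 2)%:E * (x * x) + y * y.
Proof.
move=> th0; case: x => [x| |]// x0; case: y => [y| |]// y0.
- rewrite -!EFinM -EFinD lee_fin; have := sqr_ge0 (th * x - y)%R; nra.
- by rewrite mulyy addey ?leey// -!EFinM.
- by rewrite mulyy gt0_muley ?lte_fin ?exprn_gt0// addye ?leey// -EFinM.
- by rewrite !mulyy !gt0_muley ?lte_fin ?exprn_gt0 ?mulr_gt0// leey.
Qed.

End autocorrelation.

Section square_of_sum.
Context {R : realType}.
Local Notation mu := (@lebesgue_measure R).
Local Open Scope ereal_scope.

Lemma ge0_sqreD (u v : \bar R) : 0 <= u -> 0 <= v ->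
  (u + v) * (u + v) = (u * u + v * v) + (u * v + u * v).
Proof.
move=> u0 v0; rewrite ge0_muleDl ?adde_ge0// !ge0_muleDr// (muleC v u).
by rewrite -!addeA; congr (_ + _); rewrite addeA addeC.
Qed.

Lemma ge0_integral_sqreD (u v : R -> \bar R) :
  measurable_fun [set: R] u -> measurable_fun [set: R] v ->
  (forall x, 0 <= u x) -> (forall x, 0 <= v x) ->
  \int[mu]_y ((u y + v y) * (u y + v y)) =
  (\int[mu]_y (u y * u y) + \int[mu]_y (v y * v y)) +
  (\int[mu]_y (u y * v y) + \int[mu]_y (u y * v y)).
Proof.
move=> mu_ mv u0 v0.
have muu := emeasurable_funM mu_ mu_; have mvv := emeasurable_funM mv mv.
have muv := emeasurable_funM mu_ mv.
have uu0 y : 0 <= u y * u y by rewrite mule_ge0.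
have vv0 y : 0 <= v y * v y by rewrite mule_ge0.
have uv0 y : 0 <= u y * v y by rewrite mule_ge0.
transitivity (\int[mu]_y ((u y * u y + v y * v y) + (u y * v y + u y * v y))).
  by apply: eq_integral => y _; exact: ge0_sqreD.
rewrite ge0_integralD //.
- by rewrite !ge0_integralD.
- by move=> y _; rewrite adde_ge0.
- exact: emeasurable_funD.
- by move=> y _; rewrite adde_ge0.
- exact: emeasurable_funD.
Qed.

End square_of_sum.


(** * The energy of the convolution plus the correlation of [f] with [e] *)

Section energy.
Context {R : realType}.
Local Notation mu := (@lebesgue_measure R).
Local Open Scope ereal_scope.
Variables f e w : R -> \bar R.
Hypotheses (mf : measurable_fun [set: R] f) (me : measurable_fun [set: R] e)
  (mw : measurable_fun [set: R] w).
Hypotheses (f0 : forall x, 0 <= f x) (e0 : forall x, 0 <= e x) (w0 : forall x, 0 <= w x).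

Let U := convo f e.
Let V := corr f e.
Let K := corr e e.
Let mU : measurable_fun [set: R] U. Proof. exact: measurable_convo. Qed.
Let mV : measurable_fun [set: R] V. Proof. exact: measurable_corr. Qed.
Let U0 x : 0 <= U x. Proof. exact: convo_ge0. Qed.
Let V0 x : 0 <= V x. Proof. exact: corr_ge0. Qed.
Let K0 x : 0 <= K x. Proof. exact: corr_ge0. Qed.
Let mK : measurable_fun [set: R] K. Proof. exact: measurable_corr. Qed.

Let mFsub : measurable_fun [set: R * R] (fun z : R * R => e (z.2 - z.1)%R).
Proof. exact: measurable_comp_sub. Qed.

Let mFadd : measurable_fun [set: R * R] (fun z : R * R => e (z.2 + z.1)%R).
Proof. exact: measurable_comp_add. Qed.

Lemma convoE : U = fun y => \int[mu]_t (f t * e (y - t)%R).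
Proof. by []. Qed.

Lemma corrE : V = fun y => \int[mu]_t (f t * e (y + t)%R).
Proof. by apply/funext => y; apply: eq_integral => t _; rewrite addrC. Qed.

(** The translates [e (y - t)] and [e (y - s)] are offset by [s - t], so their inner product is
    [K (s - t)] and [integral_corrM] applies. *)
Lemma integral_convo_sqr :
  \int[mu]_y (U y * U y) = \int[mu]_x (corr f f x * K x).
Proof.
rewrite convoE (integral_prod_integral _ _ _ _ mf mf mFsub mFsub) //.
rewrite -(integral_corrM _ _ _ mf mf mK f0 f0 K0).
apply: eq_integral => t _; apply: eq_integral => s _; congr (_ * _) => /=.
rewrite -(@ge0_integral_shift _ (fun y => e (y - t)%R * e (y - s)%R) s).
- by apply: eq_integral => y _; rewrite addrK muleC addrA.
- by apply: emeasurable_funM; exact: measurable_comp_sub.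
- by move=> y; rewrite mule_ge0.
Qed.

Lemma integral_corr_sqr :
  \int[mu]_y (V y * V y) = \int[mu]_x (corr f f x * K x).
Proof.
rewrite corrE (integral_prod_integral _ _ _ _ mf mf mFadd mFadd) //.
rewrite -(integral_corrM _ _ _ mf mf mK f0 f0 K0).
apply: eq_integral => t _; apply: eq_integral => s _; congr (_ * _) => /=.
rewrite -(@ge0_integral_shift _ (fun y => e (y + t)%R * e (y + s)%R) (- t)%R).
- by apply: eq_integral => y _; rewrite addrNK addrAC addrA.
- by apply: emeasurable_funM; exact: measurable_comp_add.
- by move=> y; rewrite mule_ge0.
Qed.

(** [e (y - t)] and [e (y + s)] are offset by [t + s]: this cross term is where the autoconvolution
    of [f] appears. *)
Lemma integral_convo_corr :
  \int[mu]_y (U y * V y) = \int[mu]_x (convo f f x * K x).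
Proof.
rewrite convoE corrE (integral_prod_integral _ _ _ _ mf mf mFsub mFadd) //.
rewrite -(integral_convoM _ _ _ mf mf mK f0 f0 K0).
apply: eq_integral => t _; apply: eq_integral => s _; congr (_ * _) => /=.
rewrite -(@ge0_integral_shift _ (fun y => e (y - t)%R * e (y + s)%R) t).
- by apply: eq_integral => y _; rewrite addrK addrA.
- by apply: emeasurable_funM; [exact: measurable_comp_sub|exact: measurable_comp_add].
- by move=> y; rewrite mule_ge0.
Qed.

Lemma integral_sqr_convoDcorr :
  \int[mu]_y ((U y + V y) * (U y + V y)) =
  (\int[mu]_x (corr f f x * K x) + \int[mu]_x (convo f f x * K x)) +
  (\int[mu]_x (corr f f x * K x) + \int[mu]_x (convo f f x * K x)).
Proof.
have aux (a b c x y : \bar R) : a = x -> b = x -> c = y ->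
    a + b + (c + c) = (x + y) + (x + y).
  by move=> -> -> ->; exact: addeACA.
apply: (etrans (ge0_integral_sqreD _ _ mU mV U0 V0)).
exact: (aux _ _ _ _ _ integral_convo_sqr integral_corr_sqr integral_convo_corr).
Qed.

End energy.

(** * The energy inequality *)

Section test_functions.
Context {R : realType}.
Local Notation mu := (@lebesgue_measure R).
Local Open Scope ereal_scope.
Variables f e w : R -> \bar R.
Hypotheses (mf : measurable_fun [set: R] f) (me : measurable_fun [set: R] e)
  (mw : measurable_fun [set: R] w).
Hypotheses (f0 : forall x, 0 <= f x) (e0 : forall x, 0 <= e x) (w0 : forall x, 0 <= w x).

(** Moves the test function onto [f]. Here [corr e w] is taken at [t], in the companion below at
    [- t]; a lower bound on a symmetric interval serves both. *)
Lemma integral_convoM_corr :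
  \int[mu]_y (convo f e y * w y) = \int[mu]_t (f t * corr e w t).
Proof.
rewrite -(integral_convoM _ _ _ mf me mw f0 e0 w0).
apply: eq_integral => t _; rewrite /corr -ge0_integralZl //.
- by apply: eq_integral => s _; rewrite muleA (addrC t).
- by apply: emeasurable_funM => //; exact: measurable_comp_add.
- by move=> s _; rewrite mule_ge0.
Qed.

Lemma integral_corrM_corr :
  \int[mu]_y (corr f e y * w y) = \int[mu]_t (f t * corr e w (- t)%R).
Proof.
rewrite -(integral_corrM _ _ _ mf me mw f0 e0 w0).
apply: eq_integral => t _; rewrite /corr -ge0_integralZl //.
- by apply: eq_integral => s _; rewrite muleA.
- by apply: emeasurable_funM => //; exact: measurable_comp_sub.
- by move=> s _; rewrite mule_ge0.
Qed.

End test_functions.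

Section probability_density.
Context {R : realType}.
Local Notation mu := (@lebesgue_measure R).
Local Open Scope ereal_scope.
Variable f : R -> \bar R.
Hypotheses (mf : measurable_fun [set: R] f) (f0 : forall x, 0 <= f x).

Lemma le_integral_weighted (g : R -> \bar R) (T : R) :
  measurable_fun [set: R] g -> (forall x, 0 <= g x) -> \int[mu]_x f x = 1 ->
  (0 <= T)%R -> (forall x, f x != 0 -> T%:E <= g x) ->
  T%:E <= \int[mu]_x (f x * g x).
Proof.
move=> mg g0 f1 T0 fg.
have -> : T%:E = \int[mu]_x (T%:E * f x) by rewrite ge0_integralZl // f1 mule1.
apply: ge0_le_integral => //.
- by move=> x _; rewrite mule_ge0.
- exact: emeasurable_funM.
- exact: emeasurable_funM.
- move=> x _; rewrite muleC; have [->|fx] := eqVneq (f x) 0; first by rewrite !mul0e.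
  by rewrite lee_pmul // ?lee_fin // fg.
Qed.

Lemma integral_corr (e : R -> \bar R) (A B : R) : measurable_fun [set: R] e ->
  (forall x, 0 <= e x) -> \int[mu]_x f x = A%:E -> \int[mu]_x e x = B%:E ->
  \int[mu]_x corr f e x = (A * B)%:E.
Proof.
move=> me e0 fA eB.
have := integral_corrM _ _ (cst 1) mf me (measurable_cst 1) f0 e0 (fun=> lee01).
under [X in _ = X]eq_integral do rewrite mule1.
move=> <-; transitivity (\int[mu]_t (f t * B%:E)).
  apply: eq_integral => t _; rewrite -eB -ge0_integralZl //.
  by apply: eq_integral => s _; rewrite mule1.
rewrite ge0_integralZr // ?fA ?EFinM //.
by rewrite -eB integral_ge0.
Qed.

Lemma integral_convo (e : R -> \bar R) (A B : R) : measurable_fun [set: R] e ->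
  (forall x, 0 <= e x) -> \int[mu]_x f x = A%:E -> \int[mu]_x e x = B%:E ->
  \int[mu]_x convo f e x = (A * B)%:E.
Proof.
move=> me e0 fA eB.
have := integral_convoM _ _ (cst 1) mf me (measurable_cst 1) f0 e0 (fun=> lee01).
under [X in _ = X]eq_integral do rewrite mule1.
move=> <-; transitivity (\int[mu]_t (f t * B%:E)).
  apply: eq_integral => t _; rewrite -eB -ge0_integralZl //.
  by apply: eq_integral => s _; rewrite mule1.
rewrite ge0_integralZr // ?fA ?EFinM //.
by rewrite -eB integral_ge0.
Qed.

Lemma ge0_integral_bound (g k : R -> \bar R) (M : R) : measurable_fun [set: R] g ->
  measurable_fun [set: R] k -> (forall x, 0 <= g x) -> (forall x, 0 <= k x) ->
  (forall x, g x <= M%:E) ->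
  \int[mu]_x (g x * k x) <= M%:E * \int[mu]_x k x.
Proof.
move=> mg mk g0 k0 gM.
have M0 : 0 <= M%:E by exact: le_trans (g0 0%R) (gM 0%R).
rewrite -ge0_integralZl //; apply: ge0_le_integral => //.
- by move=> x _; rewrite mule_ge0.
- exact: emeasurable_funM.
- exact: emeasurable_funM.
- by move=> x _; rewrite lee_wpmul2r.
Qed.

End probability_density.

(** * The lower bound for arbitrary test functions *)

Section lower_bound.
Context {R : realType}.
Local Notation mu := (@lebesgue_measure R).
Local Open Scope ereal_scope.
Variables f e w : R -> \bar R.
Hypotheses (mf : measurable_fun [set: R] f) (me : measurable_fun [set: R] e)
  (mw : measurable_fun [set: R] w).
Hypotheses (f0 : forall x, 0 <= f x) (e0 : forall x, 0 <= e x) (w0 : forall x, 0 <= w x).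
Hypothesis f1 : \int[mu]_x f x = 1.
Hypothesis f_supp : forall x, f x != 0 -> (`|x| <= 1 / 4)%R.
Variables A T W K2 M : R.
Hypothesis fM : forall x, convo f f x <= M%:E.
Hypothesis eA : \int[mu]_x e x = A%:E.
Hypothesis T0 : (0 <= T)%R.
Hypothesis ewT : forall t, (`|t| <= 1 / 4)%R -> T%:E <= corr e w t.
Hypothesis wW : \int[mu]_x (w x * w x) <= W%:E.
Hypothesis eK2 : \int[mu]_x (corr e e x * corr e e x) <= K2%:E.

Let K := corr e e.
Let mK : measurable_fun [set: R] K. Proof. exact: measurable_corr. Qed.
Let K0 x : 0 <= K x. Proof. exact: corr_ge0. Qed.
Let c := corr f f.
Let mc : measurable_fun [set: R] c. Proof. exact: measurable_corr. Qed.
Let c0 x : 0 <= c x. Proof. exact: corr_ge0. Qed.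
Let g := convo f f.
Let mg : measurable_fun [set: R] g. Proof. exact: measurable_convo. Qed.
Let g0 x : 0 <= g x. Proof. exact: convo_ge0. Qed.
Let X := \int[mu]_x (c x * K x).
Let Y := \int[mu]_x (g x * K x).
Let X0 : 0 <= X. Proof. by apply: integral_ge0 => x _; rewrite mule_ge0. Qed.
Let Y0 : 0 <= Y. Proof. by apply: integral_ge0 => x _; rewrite mule_ge0. Qed.

(** Integrate [2 lam w (U + V) <= lam^2 w^2 + (U + V)^2]. Each of [int U w] and [int V w] averages
    values of [corr e w] on [[-1/4, 1/4]], hence is at least [T]. The best [lam] is [2 T / W]. *)
Lemma energy_ge (lam : R) : (0 < lam)%R ->
  (4 * lam * T)%:E <= (lam ^+ 2 * W)%:E + ((X + Y) + (X + Y)).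
Proof.
move=> lam0; pose u := convo f e; pose v := corr f e.
have mu_ : measurable_fun [set: R] u by exact: measurable_convo.
have mv : measurable_fun [set: R] v by exact: measurable_corr.
have u0 x : 0 <= u x by exact: convo_ge0.
have v0 x : 0 <= v x by exact: corr_ge0.
have s0 x : 0 <= u x + v x by rewrite adde_ge0.
have ms : measurable_fun [set: R] (fun x => u x + v x) by exact: emeasurable_funD.
have mcw : measurable_fun [set: R] (corr e w) by exact: measurable_corr.
have cw0 x : 0 <= corr e w x by exact: corr_ge0.
have Tu : T%:E <= \int[mu]_y (u y * w y).
  rewrite /u (integral_convoM_corr _ _ _ mf me mw f0 e0 w0).
  by apply: le_integral_weighted => // x /f_supp; exact: ewT.
have Tv : T%:E <= \int[mu]_y (v y * w y).
  rewrite /v (integral_corrM_corr _ _ _ mf me mw f0 e0 w0).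
  apply: (le_integral_weighted _ mf f0 (fun x => corr e w (- x)%R)) => //.
    by apply: (measurableT_comp mcw); exact: oppr_measurable.
  by move=> x /f_supp; rewrite -normrN; exact: ewT.
have uw0 y : 0 <= u y * w y by rewrite mule_ge0.
have vw0 y : 0 <= v y * w y by rewrite mule_ge0.
have muw := emeasurable_funM mu_ mw; have mvw := emeasurable_funM mv mw.
have mww := emeasurable_funM mw mw; have mss := emeasurable_funM ms ms.
have mws := emeasurable_funM mw ms.
have ww0 y : 0 <= w y * w y by rewrite mule_ge0.
have ss0 y : 0 <= (u y + v y) * (u y + v y) by rewrite mule_ge0.
have lww0 y : 0 <= (lam ^+ 2)%:E * (w y * w y) by rewrite mule_ge0 // lee_fin exprn_ge0 // ltW.
have ml := measurable_funeM (lam ^+ 2)%:E mww.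
rewrite -(integral_sqr_convoDcorr _ _ mf me f0 e0).
apply: (@le_trans _ _ (\int[mu]_y ((2 * lam)%:E * (w y * (u y + v y))))).
  rewrite ge0_integralZl //; last 2 first.
  - by move=> y _; rewrite mule_ge0.
  - by rewrite lee_fin mulr_ge0 // ltW.
  under eq_integral => y _ do rewrite muleC ge0_muleDl //.
  rewrite ge0_integralD //.
  have -> : (4 * lam * T)%:E = (2 * lam)%:E * (T%:E + T%:E).
    by rewrite -EFinD -EFinM; congr EFin; ring.
  apply: lee_wpmul2l; first by rewrite lee_fin mulr_ge0 // ltW.
  exact: leeD Tu Tv.
apply: (@le_trans _ _ (\int[mu]_y ((lam ^+ 2)%:E * (w y * w y) +
    (u y + v y) * (u y + v y)))).
  apply: ge0_le_integral => //.
  - by move=> y _; rewrite !mule_ge0 // lee_fin mulr_ge0 // ltW.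
  - exact: measurable_funeM.
  - exact: emeasurable_funD.
  - by move=> y _; exact: mule_AMGM.
rewrite ge0_integralD // ge0_integralZl //; last by rewrite lee_fin exprn_ge0 // ltW.
apply: leeD2r; rewrite (EFinM (lam ^+ 2)); apply: lee_wpmul2l => //.
by rewrite lee_fin exprn_ge0 // ltW.
Qed.

Lemma convo_energy_le : Y <= (M * A ^+ 2)%:E.
Proof.
have KA : \int[mu]_x K x = (A * A)%:E by exact: integral_corr.
by rewrite expr2 EFinM -KA; exact: ge0_integral_bound.
Qed.

(** [c] itself may be unbounded, but its square has the same integral as [g^2], where [g <= M] and
    [int g = 1]. *)
Lemma integral_sqr_corr_le : \int[mu]_x (c x * c x) <= M%:E.
Proof.
rewrite (integral_sqr_corr_convo _ mf f0).
apply: le_trans (ge0_integral_bound g g M mg mg g0 g0 fM) _.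
by rewrite (integral_convo _ mf f0 f 1 1 mf f0 f1 f1) mulr1 mule1.
Qed.

Lemma corr_supp x : c x != 0 -> (- (1 / 2) <= x <= 1 / 2)%R.
Proof.
apply: contraNT => hx; apply/eqP; apply: integral0_eq => t _.
apply/eqP; rewrite mule_eq0; apply: contraNT hx; rewrite negb_or => /andP[/f_supp + /f_supp].
rewrite !ler_norml => /andP[? ?] /andP[? ?]; apply/andP; split; lra.
Qed.

(** Integrate [2 th c (K + b) <= th^2 c^2 + (K + b)^2] over [[-1/2, 1/2]], which has length 1 and
    carries [c]. Since [int c = 1], the free shift [b] enters the left side exactly. *)
Lemma corr_energy_le (b th : R) : (0 <= b)%R -> (0 < th)%R ->
  (2 * th)%:E * (X + b%:E) <= (th ^+ 2 * M + K2 + 2 * b * A ^+ 2 + b ^+ 2)%:E.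
Proof.
move=> b0 th0; pose I := `[(- (1 / 2))%R, (1 / 2)%R]%classic : set R.
pose i (x : R) : \bar R := (\1_I x)%:E.
have mI : measurable I by exact: measurable_itv.
have mi : measurable_fun [set: R] i by apply/measurable_EFinP; exact: measurable_indic.
have i0 x : 0 <= i x by rewrite lee_fin.
have iI : \int[mu]_x i x = 1.
  rewrite /i integral_indic // setIT /I.
  apply: (etrans (lebesgue_measure_itv _)); rewrite /= lte_fin.
  by rewrite ifT; [rewrite -EFinD; congr EFin; lra | lra].
have mcK := emeasurable_funM mc mK; have mcc := emeasurable_funM mc mc.
have mKK := emeasurable_funM mK mK.
have cK0 x : 0 <= c x * K x by rewrite mule_ge0.
have cc0 x : 0 <= c x * c x by rewrite mule_ge0.
have KK0 x : 0 <= K x * K x by rewrite mule_ge0.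
have bc0 x : 0 <= b%:E * c x by rewrite mule_ge0.
have mbc := measurable_funeM b%:E mc.
have KA : \int[mu]_x K x = (A * A)%:E by exact: integral_corr.
have c1 : \int[mu]_x c x = 1 by rewrite (integral_corr _ mf f0 f 1 1 mf f0 f1 f1) mulr1.
have -> : X + b%:E = \int[mu]_x (c x * K x + b%:E * c x).
  by rewrite ge0_integralD // ge0_integralZl // c1 mule1.
have thc0 x : 0 <= (th ^+ 2)%:E * (c x * c x).
  by rewrite mule_ge0 // lee_fin exprn_ge0 // ltW.
have bK0 x : 0 <= (2 * b)%:E * K x by rewrite mule_ge0 // lee_fin mulr_ge0.
have bi0 x : 0 <= (b ^+ 2)%:E * i x by rewrite mule_ge0 // lee_fin exprn_ge0.
have mthc := measurable_funeM (th ^+ 2)%:E mcc.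
have mbK := measurable_funeM (2 * b)%:E mK.
have mbi := measurable_funeM (b ^+ 2)%:E mi.
rewrite -ge0_integralZl //; first last.
- by rewrite lee_fin mulr_ge0 // ltW.
- by move=> x _; rewrite adde_ge0.
- exact: emeasurable_funD.
(* [q] equals [(K + b)^2] on the interval; the constant [b^2] is cut off outside to stay
   integrable. *)
pose q x := (K x * K x + (2 * b)%:E * K x) + (b ^+ 2)%:E * i x.
have mq1 := emeasurable_funD mKK mbK.
have mq : measurable_fun [set: R] q by exact: emeasurable_funD.
have q10 x : 0 <= K x * K x + (2 * b)%:E * K x by rewrite adde_ge0.
have q0 x : 0 <= q x by rewrite adde_ge0.
have E1 (x k : \bar R) : 0 <= k -> x * k + b%:E * x = x * (k + b%:E).
  by move=> k0; rewrite (muleC b%:E) ge0_muleDr ?lee_fin.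
have E2 (k : \bar R) : 0 <= k ->
    k * k + (2 * b)%:E * k + (b ^+ 2)%:E = (k + b%:E) * (k + b%:E).
  case: k => [k| |]// k0; first by rewrite -!EFinM -!EFinD; congr EFin; ring.
  have -> : +oo + b%:E = +oo :> \bar R by [].
  have [->|b_neq0] := eqVneq b 0%R; first by rewrite mulr0 mul0e adde0 mulyy.
  by rewrite !mulyy gt0_muley ?lte_fin ?mulr_gt0 // lt_def b_neq0.
apply: (@le_trans _ _ (\int[mu]_x ((th ^+ 2)%:E * (c x * c x) + q x))).
  apply: ge0_le_integral => //.
  - by move=> x _; rewrite mule_ge0 ?adde_ge0 // lee_fin mulr_ge0 // ltW.
  - by apply: measurable_funeM; exact: emeasurable_funD.
  - exact: emeasurable_funD.
  move=> x _; have [cx|/corr_supp Ix] := eqVneq (c x) 0.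
    rewrite [leLHS](_ : _ = 0); last by rewrite cx mul0e mule0 adde0 mule0.
    exact: adde_ge0.
  rewrite /q /i indicE mem_set //= mule1 (E1 (c x) _ (K0 x)) (E2 _ (K0 x)).
  by apply: mule_AMGM => //; rewrite adde_ge0.
rewrite ge0_integralD // ge0_integralZl //; last by rewrite lee_fin exprn_ge0 // ltW.
rewrite ge0_integralD // ge0_integralD // !ge0_integralZl // ?lee_fin ?mulr_ge0 ?exprn_ge0 //.
rewrite KA iI mule1; move: eK2 integral_sqr_corr_le; rewrite -/K.
set p := \int[mu]_x (K x * K x); set r := \int[mu]_x (c x * c x).
move: p r => p r hp hr.
have -> : (th ^+ 2 * M + K2 + 2 * b * A ^+ 2 + b ^+ 2)%:E = (th ^+ 2)%:E * M%:E +
    ((K2%:E + (2 * b)%:E * (A * A)%:E) + (b ^+ 2)%:E).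
  by rewrite -!EFinM -!EFinD; congr EFin; ring.
apply: leeD; last by apply: leeD2r; exact: leeD2r.
by apply: lee_wpmul2l => //; rewrite lee_fin exprn_ge0 // ltW.
Qed.

(** Combining [th] times [energy_ge] with the two upper bounds eliminates [X] and [Y]. What remains
    is linear in [M], so each choice of [lam], [th], [b] yields a lower bound for [M]. *)
Lemma energy_bound (lam th b : R) : (0 < lam)%R -> (0 < th)%R -> (0 <= b)%R ->
  (th * (4 * lam * T - lam ^+ 2 * W + 2 * b) <=
   (2 * th * A ^+ 2 + th ^+ 2) * M + K2 + 2 * b * A ^+ 2 + b ^+ 2)%R.
Proof.
move=> lam0 th0 b0.
have := energy_ge _ lam0; have := convo_energy_le; have := corr_energy_le _ _ b0 th0.
move: X0 Y0; case: X => [x| |]//; case: Y => [y| |]//; rewrite ?lee_fin => x0 y0.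
  move=> h1 h2 h3.
  have h4 : (th * (y + y) <= th * (M * A ^+ 2 + M * A ^+ 2))%R by rewrite ler_pM2l // lerD.
  have h5 : (th * (4 * lam * T) <= th * (lam ^+ 2 * W + (x + y + (x + y))))%R.
    by rewrite ler_pM2l.
  lra.
(* If [X] is infinite, [corr_energy_le] would bound an infinite left side by a real number. *)
have -> : +oo + b%:E = +oo :> \bar R by [].
by rewrite gt0_muley ?lte_fin ?mulr_gt0.
Qed.

End lower_bound.

(** * Sums weighted by integer lists *)

Section weighted_sums.
Context {R : realType}.
Implicit Types (l a b : seq N) (F G : nat -> R).

(* Locked so that unification never expands a large numeral in unary. *)
Definition rN (n : N) : R := locked (fun n => (BinNat.N.to_nat n)%:R) n.

Lemma rNE n : rN n = (BinNat.N.to_nat n)%:R.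
Proof. by rewrite /rN -lock. Qed.

Lemma rN0 : rN BinNums.N0 = 0. Proof. by rewrite rNE. Qed.

Lemma rND m n : rN (BinNat.N.add m n) = rN m + rN n.
Proof. by rewrite !rNE Nnat.N2Nat.inj_add natrD. Qed.

Lemma rNM m n : rN (BinNat.N.mul m n) = rN m * rN n.
Proof. by rewrite !rNE Nnat.N2Nat.inj_mul natrM. Qed.

Lemma rN_ge0 n : 0 <= rN n. Proof. by rewrite rNE. Qed.

Lemma ler_rN m n : BinNat.N.leb m n -> rN m <= rN n.
Proof.
by move=> /BinNat.N.leb_le/BinNat.N.sub_add <-; rewrite rND lerDr rN_ge0.
Qed.

Fixpoint lsum l F : R :=
  if l is x :: s then rN x * F 0%N + lsum s (fun i => F i.+1) else 0.

Lemma eq_lsum l F G : F =1 G -> lsum l F = lsum l G.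
Proof.
elim: l F G => //= x l IH F G FG; congr (_ * _ + _); first exact: FG.
by apply: IH => i; exact: FG.
Qed.

Lemma lsumZ l F (c : R) : lsum l (fun i => c * F i) = c * lsum l F.
Proof.
elim: l F => [|x l IH] F /=; first by rewrite mulr0.
by rewrite IH mulrDr mulrCA.
Qed.

Lemma lsumZr l F (c : R) : lsum l (fun i => F i * c) = lsum l F * c.
Proof. by rewrite mulrC -lsumZ; apply: eq_lsum => i; rewrite mulrC. Qed.

Lemma lsum_ge0 l F : (forall i, 0 <= F i) -> 0 <= lsum l F.
Proof.
elim: l F => //= x l IH F F0; rewrite addr_ge0 ?mulr_ge0 ?rN_ge0 ?F0//.
by apply: IH => i; exact: F0.
Qed.

Lemma lsum_cat a b F : lsum (a ++ b) F = lsum a F + lsum b (fun i => F (size a + i)%N).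
Proof.
elim: a F => [|x a IH] F /=; first by rewrite add0r.
by rewrite IH addrA.
Qed.

Lemma lsum_const_le (c : N) l F : all (fun x => BinNat.N.leb x c) l -> (forall i, 0 <= F i) ->
  lsum l F <= rN c * \sum_(i < size l) F i.
Proof.
elim: l F => [|x l IH] F /=; first by rewrite big_ord0 mulr0.
move=> /andP[xc lc] F0; rewrite big_ord_recl mulrDr lerD //.
  by rewrite ler_wpM2r // ler_rN.
by apply: IH => // i; exact: F0.
Qed.

Lemma lsum_const_ge (c : N) l F : all (fun x => BinNat.N.leb c x) l -> (forall i, 0 <= F i) ->
  rN c * \sum_(i < size l) F i <= lsum l F.
Proof.
elim: l F => [|x l IH] F /=; first by rewrite big_ord0 mulr0.
move=> /andP[xc lc] F0; rewrite big_ord_recl mulrDr lerD //.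
  by rewrite ler_wpM2r // ler_rN.
by apply: IH => // i; exact: F0.
Qed.

Definition lsqr l := [seq BinNat.N.mul x x | x <- l].

Lemma lsum_sqr_ge l F (y : R) : (forall i, 0 <= F i) ->
  2 * y * lsum l F <= lsum (lsqr l) F + y ^+ 2 * \sum_(i < size l) F i.
Proof.
elim: l F => [|x l IH] F F0 /=; first by rewrite big_ord0 !mulr0 addr0.
rewrite big_ord_recl rNM.
have := IH (fun i => F i.+1) (fun i => F0 i.+1); have := F0 0%N.
set p := F 0%N; set u := lsum l _; set v := lsum (lsqr l) _; set z := \sum_(i < _) _.
have := sqr_ge0 (rN x - y); move: (rN x) p u v z => t p u v z t0 p0 h.
by have := mulr_ge0 p0 t0; nra.
Qed.

(** Jensen's inequality for weights of sum at most 1: [lsum_sqr_ge] at [y = lsum l F]. The weights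
    will be indicators of disjoint cells or hats divided by [h]. *)
Lemma sqr_lsum_le l F : (forall i, 0 <= F i) -> \sum_(i < size l) F i <= 1 ->
  lsum l F ^+ 2 <= lsum (lsqr l) F.
Proof.
move=> F0 F1; have := lsum_sqr_ge l F (lsum l F) F0.
have : lsum l F ^+ 2 * \sum_(i < size l) F i <= lsum l F ^+ 2.
  by rewrite ler_piMr ?sqr_ge0.
by move: (\sum_(i < _) _) => z; nra.
Qed.

Definition lscale (c : N) l := [seq BinNat.N.mul c x | x <- l].

Fixpoint ladd a b : seq N :=
  match a, b with
  | x :: a', y :: b' => BinNat.N.add x y :: ladd a' b'
  | [::], _ => b
  | _, [::] => a
  end.

(** Product of polynomials in coefficient form, that is, convolution of integer lists. Binary [N]
    makes it computable on the certificates. *)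
Fixpoint lmul a b : seq N :=
  if a is x :: a' then ladd (lscale x b) (BinNums.N0 :: lmul a' b) else [::].

Lemma lsum_lscale c l F : lsum (lscale c l) F = rN c * lsum l F.
Proof.
elim: l F => [|x l IH] F /=; first by rewrite mulr0.
by rewrite IH rNM mulrDr mulrA.
Qed.

Lemma lsum_ladd a b F : lsum (ladd a b) F = lsum a F + lsum b F.
Proof.
elim: a b F => [|x a IH] [|y b] F /=; rewrite ?add0r ?addr0 //.
by rewrite IH rND mulrDl addrACA.
Qed.

Lemma lsum_lmul a b F :
  lsum (lmul a b) F = lsum a (fun i => lsum b (fun j => F (i + j)%N)).
Proof.
elim: a F => [|x a IH] F //=.
by rewrite lsum_ladd lsum_lscale /= rN0 mul0r add0r IH.
Qed.

Lemma lsum_rev l F : lsum (rev l) F = lsum l (fun i => F (size l - i.+1)%N).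
Proof.
elim: l F => [|x l IH] F //=.
rewrite rev_cons -cats1 lsum_cat /= size_rev addn0 IH addrC subn1 /= addr0.
by congr (_ + _); apply: eq_lsum => i; rewrite subSS.
Qed.

Definition lN l : N := foldr BinNat.N.add BinNums.N0 l.

Lemma lsum_const l (c : R) : lsum l (fun=> c) = rN (lN l) * c.
Proof.
elim: l => [|x l IH] /=; first by rewrite rN0 mul0r.
by rewrite IH rND mulrDl.
Qed.

End weighted_sums.

(** * Step functions *)

Section hat_functions.
Context {R : realType}.
Local Notation mu := (@lebesgue_measure R).
Implicit Types (h x y p q : R).

(** Length of the overlap of two cells of width [h] whose left ends differ by [x]; the peak value is
    [h], not 1. *)
Definition hat h x : R := Num.max 0 (h - `|x|).

(** The primitive of the indicator of [[0, h]]. A hat is a difference of two ramps, so sums of hats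
    telescope. *)
Definition ramp h x : R := Num.max 0 (Num.min h x).

Lemma hat_ge0 h x : 0 <= hat h x. Proof. by rewrite le_max lexx. Qed.

Lemma hatN h x : hat h (- x) = hat h x. Proof. by rewrite /hat normrN. Qed.

Lemma ramp_hi h x : 0 <= h -> h <= x -> ramp h x = h.
Proof. by move=> h0 hx; rewrite /ramp (min_l hx) (max_r h0). Qed.

Lemma ramp_mid h x : 0 <= x -> x <= h -> ramp h x = x.
Proof. by move=> x0 xh; rewrite /ramp (min_r xh) (max_r x0). Qed.

Lemma ramp_lo h x : x <= 0 -> ramp h x = 0.
Proof. by move=> x0; rewrite /ramp max_l // ge_min x0 orbT. Qed.

Lemma hat_ramp h x : 0 <= h -> hat h x = ramp h (x + h) - ramp h x.
Proof.
move=> h0; rewrite /hat; have [x0|/ltW x0] := leP 0 x.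
- rewrite (ramp_hi h (x + h)) ?lerDr // ger0_norm //; have [xh|/ltW xh] := leP x h.
    by rewrite ramp_mid // max_r // subr_ge0.
  by rewrite ramp_hi // subrr max_l // subr_le0.
- rewrite (ramp_lo h x) // subr0 ler0_norm // opprK addrC; have [xh|/ltW xh] := leP 0 (x + h).
    by rewrite ramp_mid ?gerDr // max_r.
  by rewrite ramp_lo // max_l.
Qed.

Lemma ramp_ge0 h x : 0 <= ramp h x. Proof. by rewrite le_max lexx. Qed.

Lemma ramp_le h x : 0 <= h -> ramp h x <= h.
Proof. by move=> h0; rewrite ge_max h0 ge_min lexx. Qed.

Lemma sum_hat h x (n : nat) : 0 <= h ->
  \sum_(i < n) hat h (x - i%:R * h) = ramp h (x + h) - ramp h (x + h - n%:R * h).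
Proof.
move=> h0; elim: n => [|n IH]; first by rewrite big_ord0 mul0r subr0 subrr.
rewrite big_ord_recr /= IH hat_ramp //.
have -> : x - n%:R * h + h = x + h - n%:R * h by ring.
have -> : x + h - n.+1%:R * h = x - n%:R * h by rewrite -natr1; ring.
by rewrite addrA subrK.
Qed.

Lemma sum_hat_le h x (n : nat) : 0 <= h -> \sum_(i < n) hat h (x - i%:R * h) <= h.
Proof.
by move=> h0; rewrite sum_hat // lerBlDr (le_trans (ramp_le _ _ h0)) // lerDl ramp_ge0.
Qed.

(** The hats are [h] times a partition of unity. A window of [n] cells meets [n.+1] grid points,
    both ends included. *)
Lemma sum_hatE h x (n : nat) : 0 <= h -> 0 <= x <= n%:R * h ->
  \sum_(i < n.+1) hat h (x - i%:R * h) = h.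
Proof.
move=> h0 /andP[x0 xn]; rewrite sum_hat // ramp_hi ?lerDr // ramp_lo ?subr0 //.
rewrite -natr1; lra.
Qed.

(* Both half-open versions are needed: [t |-> x - t] exchanges them. *)
Definition cell (b : bool) h p : set R := [set` Interval (BSide b p) (BSide b (p + h))].

Lemma measurable_cell b h p : measurable (cell b h p).
Proof. exact: measurable_itv. Qed.

Lemma cell_shift h q s t : cell true h q (s + t) = cell true h (q - t) s.
Proof. by rewrite /cell /= !in_itv /= lerBlDr (addrAC q) ltrBrDr. Qed.

Lemma cell_reflect h q x t : cell true h q (x - t) = cell false h (x - q - h) t.
Proof.
rewrite /cell /= !in_itv /= subrK lerBrDr ltrBlDr (addrC q) -lerBrDr andbC -ltrBlDr.
by congr (is_true (_ && _)); rewrite !ltrBlDr; congr (_ < _); ring.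
Qed.

Lemma indic_cell_shift h q s t :
  \1_(cell true h q) (s + t) = \1_(cell true h (q - t)) s :> R.
Proof.
rewrite !indicE; congr (nat_of_bool _)%:R.
by apply/idP/idP => /set_mem; [rewrite cell_shift|rewrite -cell_shift]; exact: mem_set.
Qed.

Lemma indic_cell_reflect h q x t :
  \1_(cell true h q) (x - t) = \1_(cell false h (x - q - h)) t :> R.
Proof.
rewrite !indicE; congr (nat_of_bool _)%:R.
by apply/idP/idP => /set_mem; [rewrite cell_reflect|rewrite -cell_reflect]; exact: mem_set.
Qed.

Lemma lebesgue_measure_cell (b : bool) h p : 0 <= h ->
  mu (cell b h p) = h%:E.
Proof.
move=> h0; rewrite /cell lebesgue_measure_itv /= lte_fin.
have [ph|ph] := ltP p (p + h); first by rewrite -EFinD addrAC subrr add0r.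
by congr EFin; lra.
Qed.

(** The order of [p] and [q] decides which cell supplies each end of the intersection; open or
    closed ends do not affect its length. *)
Lemma cell_overlap (b : bool) h p q : 0 <= h ->
  mu (cell true h p `&` cell b h q) = (hat h (p - q))%:E.
Proof.
move=> h0; have [pq|qp] := ltP p q.
  have -> : cell true h p `&` cell b h q = [set` Interval (BSide b q) (BLeft (p + h))].
    apply/seteqP; split => x; rewrite /cell /= !in_itv /=; case: b => /=; lra.
  rewrite lebesgue_measure_itv /= lte_fin /hat ltr0_norm ?subr_lt0 //.
  have [qph|qph] := ltP q (p + h).
    by rewrite -EFinD max_r; [congr EFin; lra | lra].
  by rewrite max_l //; lra.
have [qp'|pq] := ltP q p.
  have -> : cell true h p `&` cell b h q = [set` Interval (BLeft p) (BSide b (q + h))].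
    apply/seteqP; split => x; rewrite /cell /= !in_itv /=; case: b => /=; lra.
  rewrite lebesgue_measure_itv /= lte_fin /hat gtr0_norm ?subr_gt0 //.
  have [qph|qph] := ltP p (q + h).
    by rewrite -EFinD max_r; [congr EFin; lra | lra].
  by rewrite max_l //; lra.
have -> : p = q by apply/eqP; rewrite eq_le qp pq.
have -> : cell true h q `&` cell b h q =
    [set` Interval (BSide b q) (BLeft (q + h))].
  apply/seteqP; split => x; rewrite /cell /= !in_itv /=; case: b => /=; lra.
rewrite lebesgue_measure_itv /= lte_fin /hat subrr normr0 subr0 max_r //.
have [qh|qh] := ltP q (q + h); first by rewrite -EFinD addrAC subrr add0r.
by congr EFin; lra.
Qed.

Lemma integral_cell_overlap (b : bool) h p q : 0 <= h ->
  (\int[mu]_x (\1_(cell true h p) x * \1_(cell b h q) x)%:E)%E = (hat h (p - q))%:E.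
Proof.
move=> h0; rewrite -(cell_overlap b _ _ _ h0).
transitivity (\int[mu]_x (\1_(cell true h p `&` cell b h q) x)%:E)%E.
  by apply: eq_integral => x _; rewrite indicI.
rewrite integral_indic ?setIT //.
by apply: measurableI; exact: measurable_cell.
Qed.

(** The hat is the autocorrelation of the indicator of a cell of mass [h], so [integral_corr] gives
    its integral. *)
Lemma integral_hat h a : 0 <= h -> (\int[mu]_x (hat h (x + a))%:E)%E = (h * h)%:E.
Proof.
move=> h0; have mh : measurable_fun [set: R] (EFin \o hat h).
  apply/measurable_EFinP; apply: measurable_maxr => //.
  by apply: measurable_funB => //; exact: normr_measurable.
rewrite (@ge0_integral_shift _ (EFin \o hat h)) //; last first.
  by move=> x; rewrite lee_fin hat_ge0.
pose u : R -> \bar R := EFin \o \1_(cell true h 0).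
have mu_ : measurable_fun [set: R] u.
  by apply/measurable_EFinP; exact: measurable_indic (measurable_cell _ _ _).
have u0 x : (0 <= u x)%E by rewrite lee_fin.
have uh : (\int[mu]_x u x)%E = h%:E.
  rewrite integral_indic ?setIT //; last exact: measurable_cell.
  exact: lebesgue_measure_cell.
rewrite -(integral_corr _ mu_ u0 u h h mu_ u0 uh uh).
apply: eq_integral => x _.
transitivity (hat h (0 - (0 - x)))%:E; first by rewrite /= !sub0r opprK.
rewrite -(integral_cell_overlap true _ _ _ h0); apply: eq_integral => t _.
by rewrite /u /= -EFinM indic_cell_shift.
Qed.

End hat_functions.

(** * Step functions with integer heights, their correlations and convolutions *)

Section step_functions.
Context {R : realType}.
Local Notation mu := (@lebesgue_measure R).
Implicit Types (h x p q t : R) (a b l : seq N).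

Lemma eq_in_lsum l (F G : nat -> R) : (forall i, (i < size l)%N -> F i = G i) ->
  lsum l F = lsum l G.
Proof.
elim: l F G => //= x l IH F G FG; congr (_ * _ + _); first exact: FG.
by apply: IH => i il; exact: FG.
Qed.

Lemma measurable_lsum d (T : measurableType d) l (F : nat -> T -> R) :
  (forall i, measurable_fun [set: T] (F i)) ->
  measurable_fun [set: T] (fun z => lsum l (F^~ z)).
Proof.
elim: l F => [|c l IH] F mF /=; first exact: measurable_cst.
apply: measurable_funD; first by apply: measurable_funM => //; exact: measurable_cst.
by apply: (IH (fun i => F i.+1)) => i; exact: mF.
Qed.

Lemma integral_lsum l (F : nat -> R -> R) (o : nat -> R) :
  (forall i, measurable_fun [set: R] (F i)) -> (forall i x, 0 <= F i x) ->
  (forall i, \int[mu]_x (F i x)%:E = (o i)%:E)%E ->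
  (\int[mu]_x (lsum l (F^~ x))%:E = (lsum l o)%:E)%E.
Proof.
elim: l F o => [|c l IH] F o mF F0 Fo /=; first by rewrite integral0.
under eq_integral do rewrite EFinD.
rewrite ge0_integralD //.
- rewrite (IH (fun i => F i.+1) (fun i => o i.+1)) // EFinD; congr (_ + _)%E.
  under eq_integral do rewrite EFinM.
  have mF0 : measurable_fun [set: R] (EFin \o F 0%N) by apply/measurable_EFinP; exact: mF.
  have F00 x : setT x -> (0 <= (F 0%N x)%:E)%E by rewrite lee_fin.
  have c0 : (0 <= (rN c : R)%:E)%E by rewrite lee_fin rN_ge0.
  by rewrite (ge0_integralZl mu measurableT mF0 F00 c0) Fo.
- by move=> x _; rewrite lee_fin mulr_ge0 ?rN_ge0.
- by apply/measurable_EFinP; apply: measurable_funM => //; exact: mF.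
- by move=> x _; rewrite lee_fin lsum_ge0.
- by apply/measurable_EFinP; exact: (measurable_lsum _ _ _ (fun i => F i.+1)).
Qed.

Definition step h p l x : R := lsum l (fun i => \1_(cell true h (p + i%:R * h)) x).

Lemma step_ge0 h p l x : 0 <= step h p l x.
Proof. by apply: lsum_ge0 => i; rewrite indicE. Qed.

Lemma measurable_indic_cell (b : bool) h p : measurable_fun [set: R] (\1_(cell b h p) : R -> R).
Proof. by apply: measurable_indic; exact: measurable_cell. Qed.

Lemma measurable_step h p l : measurable_fun [set: R] (step h p l).
Proof.
by apply: (measurable_lsum _ _ l (fun i x => \1_(cell true h (p + i%:R * h)) x)) => i;
  exact: measurable_indic_cell.
Qed.

Lemma integral_cell (b : bool) h p : 0 <= h ->
  (\int[mu]_x (\1_(cell b h p) x)%:E = h%:E)%E.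
Proof.
move=> h0; rewrite integral_indic ?setIT; last exact: measurable_cell; last by [].
exact: lebesgue_measure_cell.
Qed.

Lemma integral_step h p l : 0 <= h ->
  (\int[mu]_x (step h p l x)%:E = (rN (lN l) * h)%:E)%E.
Proof.
move=> h0; rewrite -lsum_const.
apply: (integral_lsum l (fun i x => \1_(cell true h (p + i%:R * h)) x)) => i.
- exact: measurable_indic_cell.
- by move=> x; rewrite indicE.
- exact: integral_cell.
Qed.

(** A difference of two thresholds, so that adjacent cells telescope in [sum_cell_le]. *)
Lemma indic_cellE h p x : 0 <= h ->
  \1_(cell true h p) x = (p <= x)%R%:R - (p + h <= x)%R%:R :> R.
Proof.
move=> h0; rewrite indicE; case: (boolP (x \in _)) => [/set_mem|/negP xc].
  by rewrite /cell /= in_itv /= => /andP[-> /lt_geF ->]; rewrite subr0.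
have [px|px] := leP p x; have [phx|phx] := leP (p + h) x => //=.
- by rewrite subrr.
- by exfalso; apply: xc; apply: mem_set; rewrite /cell /= in_itv /= px.
- by exfalso; lra.
- by rewrite subrr.
Qed.

Lemma sum_cell_le h p x n : 0 <= h ->
  \sum_(i < n) \1_(cell true h (p + i%:R * h)) x <= 1 :> R.
Proof.
move=> h0; have -> : \sum_(i < n) \1_(cell true h (p + i%:R * h)) x =
    (p <= x)%R%:R - (p + n%:R * h <= x)%R%:R :> R.
  elim: n => [|n IH]; first by rewrite big_ord0 mul0r addr0 subrr.
  rewrite big_ord_recr /= IH indic_cellE // -natr1 mulrDl mul1r addrA.
  by rewrite addrA subrK.
by case: (p <= x) (_ <= x) => [] []; rewrite /= ?subrr ?subr0 ?sub0r //; lra.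
Qed.

Lemma integral_sqr_step h p l : 0 <= h ->
  (\int[mu]_x ((step h p l x)%:E * (step h p l x)%:E) <= (rN (lN (lsqr l)) * h)%:E)%E.
Proof.
move=> h0; rewrite -(integral_step h p _ h0); apply: ge0_le_integral => //.
- by move=> x _; rewrite mule_ge0 // lee_fin step_ge0.
- by apply: emeasurable_funM; apply/measurable_EFinP; exact: measurable_step.
- by apply/measurable_EFinP; exact: measurable_step.
- move=> x _; rewrite -EFinM lee_fin -expr2; apply: sqr_lsum_le; last exact: sum_cell_le.
  by move=> i; rewrite indicE.
Qed.

Lemma integral_prod_steps (c : bool) h a b (P Q : nat -> R) : 0 <= h ->
  (\int[mu]_x (lsum a (fun i => \1_(cell true h (P i)) x) *
               lsum b (fun j => \1_(cell c h (Q j)) x))%:E =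
   (lsum a (fun i => lsum b (fun j => hat h (P i - Q j))))%:E)%E.
Proof.
move=> h0.
transitivity (\int[mu]_x (lsum a (fun i => lsum b (fun j =>
    \1_(cell true h (P i)) x * \1_(cell c h (Q j)) x)))%:E)%E.
  apply: eq_integral => x _; rewrite -lsumZr; congr EFin.
  by apply: eq_lsum => i; rewrite lsumZ.
have mPQ i j : measurable_fun [set: R]
    (fun x => \1_(cell true h (P i)) x * \1_(cell c h (Q j)) x : R).
  by apply: measurable_funM; exact: measurable_indic_cell.
have PQ0 i j x : 0 <= \1_(cell true h (P i)) x * \1_(cell c h (Q j)) x :> R.
  by rewrite mulr_ge0 // indicE.
apply: (integral_lsum a (fun i x => lsum b (fun j =>
    \1_(cell true h (P i)) x * \1_(cell c h (Q j)) x))) => [i|i x|i].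
- exact: (measurable_lsum _ _ b (fun j x =>
    \1_(cell true h (P i)) x * \1_(cell c h (Q j)) x)).
- exact: lsum_ge0.
- apply: (integral_lsum b (fun j x => \1_(cell true h (P i)) x * \1_(cell c h (Q j)) x)).
  + exact: mPQ.
  + exact: PQ0.
  + by move=> j; exact: integral_cell_overlap.
Qed.

(** Overlaps in a correlation depend on [i - j]. Reading the palindrome [a] backwards turns this
    into [i + j], so the coefficients are those of a product, with origin at index [(size a).-1]. *)
Lemma corr_step h p q a b t : 0 <= h -> rev a = a ->
  corr (EFin \o step h p a) (EFin \o step h q b) t =
  (lsum (lmul a b) (fun k => hat h (t + p - q + (size a).-1%:R * h - k%:R * h)))%:E.
Proof.
move=> h0 ra; rewrite lsum_lmul -[in RHS]ra lsum_rev size_rev.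
pose P i := p + i%:R * h; pose Q j := q + j%:R * h - t.
transitivity (\int[mu]_x (lsum a (fun i => \1_(cell true h (P i)) x) *
               lsum b (fun j => \1_(cell true h (Q j)) x))%:E)%E.
  apply: eq_integral => x _; rewrite /= -EFinM; congr (_ * _)%:E.
  by apply: eq_lsum => j; rewrite indic_cell_shift.
rewrite integral_prod_steps //; congr EFin; apply: eq_in_lsum => i ia.
apply: eq_lsum => j; congr hat; rewrite /P /Q natrD.
have -> : i%:R = (size a).-1%:R - (size a - i.+1)%:R :> R.
  by rewrite -natrB; [congr (_%:R); lia | lia].
ring.
Qed.

(** Reflecting the second factor gives cells closed on the right. The cells starting at [p + i h]
    and [p + j h] convolve to a hat centred at [2 p + (i + j + 1) h], hence the extra [h]. *)
Lemma convo_step h p a x : 0 <= h ->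
  convo (EFin \o step h p a) (EFin \o step h p a) x =
  (lsum (lmul a a) (fun k => hat h (x - p - p - h - k%:R * h)))%:E.
Proof.
move=> h0; rewrite lsum_lmul.
pose P i := p + i%:R * h; pose Q j := x - (p + j%:R * h) - h.
transitivity (\int[mu]_t (lsum a (fun i => \1_(cell true h (P i)) t) *
               lsum a (fun j => \1_(cell false h (Q j)) t))%:E)%E.
  apply: eq_integral => t _; rewrite /= -EFinM; congr (_ * _)%:E.
  by apply: eq_lsum => j; rewrite indic_cell_reflect.
rewrite integral_prod_steps //; congr EFin; apply: eq_lsum => i; apply: eq_lsum => j.
by rewrite -hatN; congr hat; rewrite /P /Q natrD; ring.
Qed.

End step_functions.

Section step_function_bounds.
Context {R : realType}.
Local Notation mu := (@lebesgue_measure R).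
Implicit Types (h x p q t : R) (a b l : seq N).

(** The hats have total at most [h] at every point, so the largest coefficient controls the value
    between grid points too. *)
Lemma convo_step_le h p a (C : N) x : 0 <= h -> all (fun c => BinNat.N.leb c C) (lmul a a) ->
  (convo (EFin \o step h p a) (EFin \o step h p a) x <= (rN C * h)%:E)%E.
Proof.
move=> h0 aC; rewrite convo_step // lee_fin.
apply: le_trans (lsum_const_le _ _ _ aC (fun=> hat_ge0 _ _)) _.
by rewrite ler_wpM2l ?rN_ge0 // sum_hat_le.
Qed.

(** On the window, the [n.+1] coefficients from index [(size a).-1] carry hats of total exactly [h];
    all other terms are nonnegative and are dropped. *)
Lemma corr_step_ge h p q a b (T : N) (n : nat) t : 0 <= h -> rev a = a ->
  size (take n.+1 (drop (size a).-1 (lmul a b))) = n.+1 ->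
  all (BinNat.N.leb T) (take n.+1 (drop (size a).-1 (lmul a b))) ->
  0 <= t + p - q <= n%:R * h ->
  ((rN T * h)%:E <= corr (EFin \o step h p a) (EFin \o step h q b) t)%E.
Proof.
move=> h0 ra; set s := (size a).-1; set L := lmul a b => sL aT tn.
rewrite corr_step // lee_fin -/L -/s -(cat_take_drop s L) lsum_cat.
have ss : size (take s L) = s.
  by rewrite size_takel //; move: sL; rewrite size_take_min size_drop; lia.
rewrite -[X in _ + lsum X _](cat_take_drop n.+1 (drop s L)) lsum_cat ss.
rewrite addrCA -[leLHS]addr0 lerD //; last first.
  by rewrite addr_ge0 // lsum_ge0 // => k; exact: hat_ge0.
apply: le_trans (lsum_const_ge _ _ _ aT (fun=> hat_ge0 _ _)).
rewrite ler_wpM2l ?rN_ge0 // sL -[leLHS](sum_hatE _ _ _ h0 tn).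
apply: ler_sum => k _; rewrite le_eqVlt; apply/orP; left; apply/eqP; congr hat.
by rewrite natrD; ring.
Qed.

(** Divided by [h], the hats have sum at most 1, so [sqr_lsum_le] bounds the square by a sum of
    hats. Each hat has integral [h^2]; the normalisation contributes the third factor [h]. *)
Lemma integral_sqr_corr_step h p a : 0 < h -> rev a = a ->
  (\int[mu]_x (corr (EFin \o step h p a) (EFin \o step h p a) x *
               corr (EFin \o step h p a) (EFin \o step h p a) x) <=
   (rN (lN (lsqr (lmul a a))) * h ^+ 3)%:E)%E.
Proof.
move=> h_gt0 ra; have h0 := ltW h_gt0; set L := lmul a a.
pose F (k : nat) x := hat h (x + (p - p + (size a).-1%:R * h - k%:R * h)).
have KE x : corr (EFin \o step h p a) (EFin \o step h p a) x = (lsum L (F^~ x))%:E.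
  by rewrite corr_step //; congr EFin; apply: eq_lsum => k; congr hat; ring.
have F0 k x : 0 <= F k x by exact: hat_ge0.
have mF k : measurable_fun [set: R] (F k).
  apply: measurable_maxr => //; apply: measurable_funB => //.
  by apply: measurableT_comp; [exact: normr_measurable|exact: measurable_funD].
have sumF x : \sum_(k < size L) F k x <= h.
  have := sum_hat_le h (x + (p - p + (size a).-1%:R * h)) (size L) h0.
  apply: le_trans; apply: ler_sum => k _; rewrite le_eqVlt; apply/orP; left.
  by apply/eqP; congr hat; ring.
apply: (@le_trans _ _ (\int[mu]_x (h%:E * (lsum (lsqr L) (F^~ x))%:E))%E).
  apply: ge0_le_integral => //.
  - by move=> x _; rewrite KE -EFinM lee_fin mulr_ge0 // lsum_ge0.
  - under eq_fun do rewrite KE -EFinM.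
    by apply/measurable_EFinP; apply: measurable_funM; exact: measurable_lsum.
  - apply: measurable_funeM; apply/measurable_EFinP; exact: measurable_lsum.
  - move=> x _; rewrite KE -!EFinM lee_fin -expr2.
    have : lsum L (fun k => h^-1 * F k x) ^+ 2 <= lsum (lsqr L) (fun k => h^-1 * F k x).
      apply: sqr_lsum_le => [k|]; first by rewrite mulr_ge0 // invr_ge0.
      by rewrite -mulr_sumr ler_pdivrMl // mulr1.
    rewrite !lsumZ exprMn.
    rewrite exprVn ler_pdivrMl ?exprn_gt0 // mulrA.
    by rewrite expr2 mulfK // gt_eqF.
rewrite ge0_integralZl //.
- rewrite (integral_lsum (lsqr L) F (fun=> h * h)) // => [|k].
    by rewrite lsum_const -EFinM lee_fin mulrCA !exprS expr0 mulr1.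
  exact: integral_hat.
- by apply/measurable_EFinP; exact: measurable_lsum.
- by move=> x _; rewrite lee_fin lsum_ge0.
Qed.

End step_function_bounds.

(** * Lebesgue measurable densities *)

Section lebesgue_measurable_functions.
Context {R : realType}.
Local Notation mu := (@lebesgue_measure R).
Local Notation cmu := (@completed_lebesgue_measure R).
Local Open Scope ereal_scope.

Lemma borel_lebesgue (A : set R) : measurable A ->
  measurable (A : set (lebesgueTypeR R)).
Proof. by move=> mA; exact: sub_caratheodory. Qed.

Lemma measurable_fun_borel_lebesgue d (T : measurableType d) (k : R -> T) :
  measurable_fun [set: R] k -> measurable_fun [set: lebesgueTypeR R] k.
Proof. by move=> mk _ Y mY; apply: borel_lebesgue; exact: mk. Qed.

(** The identity map pushes the completed measure forward to Lebesgue measure on Borel sets. *)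
Lemma integral_completed (k : R -> \bar R) : measurable_fun [set: R] k ->
  (forall x, 0 <= k x) -> \int[cmu]_x k x = \int[mu]_x k x.
Proof.
move=> mk k0.
have mid : measurable_fun [set: lebesgueTypeR R] (id : _ -> measurableTypeR R).
  exact: (measurable_fun_borel_lebesgue _ (measurableTypeR R) id).
transitivity (\int[pushforward cmu (id : lebesgueTypeR R -> measurableTypeR R)]_x k x).
  by rewrite ge0_integral_pushforward.
by apply: eq_measure_integral => A mA _.
Qed.

(** The integral of a nonnegative function is a supremum over simple functions below it, hence
    monotone for arbitrary functions. It will be applied to the integrand of [autoconv f]. *)
Lemma ge0_le_integral_nomeas d (T : measurableType d)
    (nu : {measure set T -> \bar R}) (f g : T -> \bar R) :
  (forall x, 0 <= f x) -> (forall x, f x <= g x) ->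
  \int[nu]_x f x <= \int[nu]_x g x.
Proof.
move=> f0 fg; have g0 x : 0 <= g x by exact: le_trans (f0 x) (fg x).
rewrite !ge0_integralTE //; apply: ereal_sup_le => _ [h /= hf <-].
by exists h => // x; exact: le_trans (hf x) (fg x).
Qed.

(** A Lebesgue measurable set is a Borel set together with a null set; [B] is the Borel part. *)
Lemma lebesgue_measurable_borel (A : set R) :
  measurable (A : set (lebesgueTypeR R)) ->
  exists2 B : set R, measurable B /\ B `<=` A & mu.-negligible (A `\` B).
Proof.
move=> mA; have : (completed_algebra_gen mu).-sigma.-measurable A.
  by rewrite completed_caratheodory_measurable.
rewrite g_sigma_completed_algebra_genE => -[B mB [Z negZ BZA]].
exists B; first by split => //; rewrite -BZA; exact: subsetUl.
by apply: negligibleS negZ => x; rewrite -BZA => -[[|//]].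
Qed.

Lemma negligible_completed (Z : set R) : mu.-negligible Z -> cmu.-negligible Z.
Proof. by move=> [B [mB B0 ZB]]; exists B; split => //; exact: borel_lebesgue. Qed.

(* A Borel minorant is enough: the autoconvolution is monotone. *)
Lemma borel_minorant (f : R -> R) : measurable_fun [set: lebesgueTypeR R] f ->
  (forall x, 0 <= f x)%R ->
  exists k : R -> \bar R, [/\ measurable_fun [set: R] k, forall x, 0 <= k x,
    forall x, k x <= (f x)%:E & \int[mu]_x k x = \int[cmu]_x (f x)%:E].
Proof.
move=> mf f0; pose q n : R := ratr (odflt 0%R (unpickle n : option rat)).
have mA n : measurable ([set x | (q n < f x)%R] : set (lebesgueTypeR R)).
  rewrite (_ : [set x | _] = [set: lebesgueTypeR R] `&` f @^-1` `]q n, +oo[%classic).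
    by apply: mf => //; exact: measurable_itv.
  by rewrite setTI; apply/seteqP; split => x /=; rewrite in_itv /= andbT.
pose B n := sval (cid2 (lebesgue_measurable_borel _ (mA n))).
have BP n : [/\ measurable (B n), forall x, B n x -> (q n < f x)%R &
    mu.-negligible ([set x | (q n < f x)%R] `\` B n)].
  by rewrite /B; case: cid2 => ? [].
(* The level [q n], cut at 0, on the Borel part of [f > q n], where [q] enumerates the rationals.
   The supremum of these functions is the minorant. *)
pose u n x : \bar R := (Num.max 0 (q n) * \1_(B n) x)%:E.
have u0 n x : 0 <= u n x by rewrite lee_fin mulr_ge0 // ?le_max ?lexx // indicE.
have uf n x : u n x <= (f x)%:E.
  rewrite lee_fin indicE; case: (boolP (x \in B n)) => [/set_mem|_].
    by have [_ + _] := BP n => /[apply] qf; rewrite mulr1 ge_max f0 ltW.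
  by rewrite mulr0.
have mu_ n : measurable_fun [set: R] (u n).
  apply/measurable_EFinP; apply: measurable_funM => //.
  by apply: measurable_indic; have [] := BP n.
pose k x := esups (u^~ x) 0%N.
have uk n x : u n x <= k x by apply: ereal_sup_ubound; exists n.
have k0 x : 0 <= k x by exact: le_trans (u0 0%N x) (uk _ _).
have kf x : k x <= (f x)%:E by apply: ge_ereal_sup => _ [n _ <-]; exact: uf.
have mk : measurable_fun [set: R] k by exact: measurable_fun_esups.
exists k; split => //; rewrite -integral_completed //.
apply: ge0_ae_eq_integral.
- exact: measurableT.
- exact: measurable_fun_borel_lebesgue.
- exact/measurable_EFinP.
- by move=> x _; exact: k0.
- by move=> x _; rewrite lee_fin.
(* Where [k x < f x], a rational lies strictly between. The point is in its superlevel set but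
   outside the Borel part, hence in this null set. *)
have negU : cmu.-negligible (\bigcup_n ([set x | (q n < f x)%R] `\` B n)).
  by apply: negligible_bigcup => n; apply: negligible_completed; have [] := BP n.
apply: negligibleS negU.
move=> x /= /not_implyP[_ /eqP kfx].
have kltf : k x < (f x)%:E by rewrite lt_neqAle kfx kf.
have [r kr] : exists r, k x = r%:E.
  by exists (fine (k x)); rewrite fineK // ge0_fin_numE // (lt_trans kltf) ?ltry.
move: kltf; rewrite kr lte_fin => /rat_in_itvoo[c]; rewrite in_itv /= => /andP[rc cf].
exists (pickle c) => //; have qc : q (pickle c) = ratr c by rewrite /q pickleK.
split => [|Bx]; first by rewrite /= qc.
have := uk (pickle c) x; rewrite kr lee_fin qc indicE mem_set // mulr1 ge_max.
by rewrite (lt_geF rc) andbF.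
Qed.

End lebesgue_measurable_functions.

(** * Certificates *)

Section certificates.
Import BinNat.
Local Open Scope N_scope.

(** Heights of [e] on 65 cells. The list is a palindrome, as [corr_step] requires. *)
Definition lower_eta : seq N :=
[:: 1702; 862; 665; 576; 496; 439; 397; 364; 338; 325; 321; 313; 304; 297; 290; 285; 280; 275;
270; 265; 257; 242; 234; 229; 223; 219; 214; 209; 206; 203; 201; 200; 200; 200; 201; 203; 206;
209; 214; 219; 223; 229; 234; 242; 257; 265; 270; 275; 280; 285; 290; 297; 304; 313; 321; 325;
338; 364; 397; 439; 496; 576; 665; 862; 1702].

(* Up to rounding, the convolution of [lower_eta] with the probability measure on the grid points
   of [-1/4, 1/4] that minimises the energy of the kernel [K]. *)
Definition lower_omega : seq N :=
[:: 1133; 1166; 1213; 1270; 1293; 1307; 1316; 1323; 1328; 1330; 1328; 1326; 1326; 1327; 1329;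
1330; 1332; 1334; 1337; 1340; 1345; 1352; 1359; 1365; 1370; 1375; 1380; 1383; 1384; 1384; 1384;
1384; 1383; 1383; 1382; 1382; 1382; 1382; 1386; 1391; 1398; 1405; 1414; 1429; 1467; 1500; 1526;
1550; 1571; 1589; 1606; 1621; 1635; 1647; 1655; 1646; 1641; 1660; 1695; 1747; 1822; 1928; 2062;
2289; 3000; 2289; 2047; 1918; 1882; 1852; 1826; 1801; 1778; 1754; 1730; 1710; 1692; 1675; 1659;
1644; 1630; 1618; 1607; 1598; 1590; 1585; 1578; 1570; 1564; 1557; 1551; 1547; 1542; 1536; 1528;
1519; 1509; 1497; 1484; 1470; 1455; 1437; 1416; 1395; 1374; 1351; 1326; 1296; 1258; 1248; 1250;
1254; 1259; 1265; 1273; 1280; 1287; 1295; 1303; 1314; 1339; 1372; 1399; 1424; 1448; 1471; 1495;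
1521; 1549; 1579; 1613; 1657; 1708; 1731; 1746; 1758; 1768; 1777; 1781; 1782; 1782; 1782; 1780;
1778; 1775; 1772; 1768; 1764; 1761; 1758; 1758; 1758; 1758; 1758; 1758; 1758; 1761; 1764; 1768;
1772; 1775; 1778; 1780; 1782; 1782; 1782; 1781; 1777; 1768; 1758; 1746; 1731; 1708; 1657; 1613;
1579; 1549; 1521; 1495; 1471; 1448; 1424; 1399; 1372; 1339; 1314; 1303; 1295; 1287; 1280; 1273;
1265; 1259; 1254; 1250; 1248; 1258; 1296; 1326; 1351; 1374; 1395; 1416; 1437; 1455; 1470; 1484;
1497; 1509; 1519; 1528; 1536; 1542; 1547; 1551; 1557; 1564; 1570; 1578; 1585; 1590; 1598; 1607;
1618; 1630; 1644; 1659; 1675; 1692; 1710; 1730; 1754; 1778; 1801; 1826; 1852; 1882; 1918; 2047;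
2289; 3000; 2289; 2062; 1928; 1822; 1747; 1695; 1660; 1641; 1646; 1655; 1647; 1635; 1621; 1606;
1589; 1571; 1550; 1526; 1500; 1467; 1429; 1414; 1405; 1398; 1391; 1386; 1382; 1382; 1382; 1382;
1383; 1383; 1384; 1384; 1384; 1384; 1383; 1380; 1375; 1370; 1365; 1359; 1352; 1345; 1340; 1337;
1334; 1332; 1330; 1329; 1327; 1326; 1326; 1328; 1330; 1328; 1323; 1316; 1307; 1293; 1270; 1213;
1166; 1133].

(** Heights on the 240 cells of mesh [1/480] that fill [[-1/4, 1/4]], before division by the
    mass. *)
Definition upper_steps : seq N :=
[:: 8643; 1630; 2; 2; 37; 457; 867; 295; 6257; 955; 233; 1234; 621; 880; 1605; 1193; 5279; 809;
736; 1209; 794; 1271; 1472; 1321; 4659; 418; 1041; 2111; 1463; 1514; 2402; 2794; 4893; 1274; 771;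
1294; 987; 1335; 2340; 2925; 4289; 1075; 1298; 1740; 1079; 1142; 2009; 2336; 3388; 640; 1187;
1746; 1068; 847; 1801; 2205; 2807; 431; 1483; 2270; 2374; 2202; 2648; 2572; 2466; 128; 1177; 1765;
2158; 2365; 3438; 3289; 2507; 13; 714; 2004; 2403; 1722; 599; 818; 1527; 6531; 3504; 1996; 2470;
1969; 708; 877; 1045; 915; 541; 431; 79; 335; 360; 250; 550; 514; 381; 106; 299; 316; 132; 655; 5;
5; 8; 5; 525; 659; 445; 854; 1248; 1155; 1331; 733; 323; 4; 2; 1; 3; 30; 372; 50; 98; 7; 3; 6; 15;
16; 835; 1124; 1344; 1196; 892; 929; 1043; 1354; 1964; 2229; 3228; 3390; 3832; 2905; 2864; 2869;
2878; 2823; 2063; 2276; 1672; 3; 5; 4; 3; 503; 664; 348; 1056; 2690; 2326; 1895; 103; 324; 401;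
386; 466; 1043; 846; 377; 813; 391; 5; 378; 387; 318; 718; 765; 755; 700; 886; 757; 642; 817; 473;
948; 1168; 1082; 942; 713; 468; 281; 278; 56; 3; 2; 16; 70; 154; 2; 1; 8; 58; 5; 4; 1; 1; 1; 1;
25; 173; 8; 2; 1; 1; 1; 19; 11; 2; 48; 4; 0; 1; 2; 33; 924; 794; 1049; 1388; 1724; 1920; 3; 5921;
5393; 5681; 5518; 5125; 4986; 4777; 5628].

Definition grid : N := 480.

(** A lower bound for the 241 coefficients of the product of [lower_eta] and [lower_omega] that
    govern [[-1/4, 1/4]]. *)
Definition lower_T : N := 37235676.

(* With [A] the sum of [lower_eta], the optimal parameters of [energy_bound] are about
   [th = lower_t / grid ^ 2], [b = lower_b / grid ^ 2], [lam = lower_l / lower_d], where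
   [lower_b = lower_t - A ^ 2]. *)
Definition lower_t : N := 1927269567.

Definition lower_b : N := 1370215163.

Definition lower_l : N := 1005.

Definition lower_d : N := 10000.

Definition upper_C : N := 283075316.

End certificates.

(** * Reduction of the lower bound to an inequality of integers *)

Section arithmetic.
Import BinNat.

(** This and the next two definitions are the terms of [energy_bound] cleared of denominators. The
    negative term in [lam^2 W] moves to [energy_error], so that everything stays in [N]. *)
Definition energy_const (H t b l d T : N) : N := (H * 4 * t * l * d * T + 2 * t * b * d * d)%N.

Definition energy_slope (t d A : N) : N := ((2 * t * A * A + t * t) * d * d)%N.

Definition energy_error (H t b l d A W C : N) : N :=
  (H * C * d * d + 2 * b * A * A * d * d + b * b * d * d + H * t * l * l * W)%N.

Definition lower_certificate (H t b l d T A W C : N) : bool :=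
  [&& N.leb 1 H, N.leb 1 d, N.leb 1 t &
  N.leb (12748 * energy_slope t d A + 10000 * energy_error H t b l d A W C)
        (10000 * energy_const H t b l d T)]%N.

End arithmetic.

Section arithmetic_bounds.
Context {R : realType}.

Lemma rN_gt0 n : BinNat.N.leb (BinNums.Npos BinNums.xH) n -> 0 < rN n :> R.
Proof. by move=> /(ler_rN (R := R)); apply: lt_le_trans; rewrite rNE. Qed.

End arithmetic_bounds.

Section literals.
Import BinNat.

Lemma rN_literals (R : realType) : ((rN 2%N = 2 :> R) * (rN 4%N = 4 :> R) *
  (rN 10000%N = 10000 :> R) * (rN 12748%N = 12748 :> R) * (rN 15098%N = 15098 :> R) *
  (rN 480%N = 480 :> R))%type.
Proof. by do !split; rewrite rNE; congr (_%:R); vm_compute. Qed.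

End literals.

Section energy_arithmetic.
Context {R : realType}.

Lemma ratio_le (D E L M p q : R) : 0 < D -> 0 < q -> p * D + q * E <= q * L ->
  L <= D * M + E -> p / q <= M.
Proof.
move=> D0 q0 pL LM; rewrite ler_pdivrMr // -(ler_pM2l D0).
have : q * L <= q * (D * M + E) by rewrite ler_pM2l.
lra.
Qed.

(* [lower_certificate] is the energy bound multiplied by [H ^ 4 * d ^ 2]. *)
Lemma lower_bound_arith (H t b l d T A W C : N) (M : R) (h := (rN H : R)^-1) :
  lower_certificate H t b l d T A W C ->
  (rN t * h ^+ 2) * (4 * (rN l / rN d) * (rN T * h) - (rN l / rN d) ^+ 2 * (rN W * h)
     + 2 * (rN b * h ^+ 2)) <=
    (2 * (rN t * h ^+ 2) * (rN A * h) ^+ 2 + (rN t * h ^+ 2) ^+ 2) * M + rN C * h ^+ 3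
     + 2 * (rN b * h ^+ 2) * (rN A * h) ^+ 2 + (rN b * h ^+ 2) ^+ 2 ->
  12748 / 10000 <= M.
Proof.
move=> /and4P[/(rN_gt0 (R := R)) H0 /(rN_gt0 (R := R)) d0 /(rN_gt0 (R := R)) t0 cert] ineq.
move: cert => /(ler_rN (R := R)); rewrite /energy_slope /energy_error /energy_const.
rewrite !(rND, rNM, rN_literals).
move: ineq H0 d0 t0; rewrite /h => {h}.
move: (rN H) (rN t) (rN b) (rN l) (rN d) (rN T) (rN A) (rN W) (rN C).
move=> {}H {}t {}b {}l {}d {}T {}A {}W {}C.
move=> ineq H0 d0 t0 cert.
apply: ratio_le (cert) _.
- rewrite !mulr_gt0 // ltr_wpDl ?mulr_gt0 //.
  by rewrite -mulrA -expr2 mulr_ge0 ?sqr_ge0 // mulr_ge0 // ltW.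
- by rewrite ltr0n.
(* This factor clears all denominators: the two differences of sides then agree as rational
   expressions. *)
have k0 : 0 <= H ^+ 4 * d ^+ 2 by rewrite mulr_ge0 // exprn_ge0 // ltW.
rewrite -subr_ge0; move: (ler_wpM2l k0 ineq); rewrite -subr_ge0; congr (_ <= _).
by field; rewrite !gt_eqF.
Qed.

End energy_arithmetic.

(** * The lower bound 1.2748 *)

Section main_bounds.
Context {R : realType}.
Local Notation mu := (@lebesgue_measure R).
Local Notation h := ((rN grid)^-1 : R).

Lemma grid_gt0 : 0 < rN grid :> R. Proof. exact: rN_gt0. Qed.

Lemma gridE : rN grid = 480 :> R. Proof. by rewrite /grid rN_literals. Qed.

Lemma h_gt0 : 0 < h. Proof. by rewrite invr_gt0 grid_gt0. Qed.

Lemma half_grid : 240%:R * h = 1 / 2.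
Proof. by rewrite gridE; field. Qed.

(** In the shape of [corr_step_ge]: [e] starts at [p = 0] and [w] at [q = -1/4], with a window of
    240 cells. *)
Lemma quarter_window (t : R) : `|t| <= 1 / 4 -> 0 <= t + 0 - - (1 / 4) <= 240%:R * h.
Proof. by rewrite ler_norml half_grid => /andP[t1 t2]; apply/andP; split; lra. Qed.

(** A Borel minorant [k] has the mass of [f] and a no larger autoconvolution, so [energy_bound] for
    [k] bounds the supremum for [f]. *)
Lemma sup_autoconv_ge (f : R -> R) : @admissible R f ->
  ((12748 / 10000)%:E <= sup_autoconv f)%E.
Proof.
move=> [mf f0 fsupp f1].
have [k [mk k0 kf k1]] := borel_minorant f mf f0.
have autoconv_le x : (autoconv f x <= sup_autoconv f)%E.
  by apply: ereal_sup_ubound; exists x.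
have convo_le x : (convo k k x <= sup_autoconv f)%E.
  apply: le_trans (autoconv_le x); rewrite /convo -integral_completed.
  - apply: ge0_le_integral_nomeas => t; first by rewrite mule_ge0.
    by rewrite EFinM lee_pmul.
  - by apply: emeasurable_funM => //; exact: measurable_comp_sub.
  - by move=> t; rewrite mule_ge0.
(* The value [+oo] satisfies the bound, and [-oo] is excluded because [convo k k] is nonnegative. *)
move: convo_le; case: (sup_autoconv f) => [M| |] convo_le; last 2 first.
- exact: leey.
- by have := le_trans (convo_ge0 _ _ 0 k0 k0) (convo_le 0).
rewrite lee_fin.
have k_supp x : k x != 0%E -> `|x| <= 1 / 4.
  move=> kx; have : f x != 0.
    apply: contraNneq kx => fx; rewrite eq_le k0 andbT.
    by have := kf x; rewrite fx.
  by move=> /fsupp /=; rewrite in_itv /= ler_norml.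
have h0 := ltW h_gt0.
have ra : rev lower_eta = lower_eta by vm_compute.
pose e : R -> \bar R := EFin \o step h 0 lower_eta.
pose w : R -> \bar R := EFin \o step h (- (1 / 4)) lower_omega.
have me : measurable_fun [set: R] e by apply/measurable_EFinP; exact: measurable_step.
have mw : measurable_fun [set: R] w by apply/measurable_EFinP; exact: measurable_step.
have e0 x : (0 <= e x)%E by rewrite lee_fin step_ge0.
have w0 x : (0 <= w x)%E by rewrite lee_fin step_ge0.
have eA := integral_step h 0 lower_eta h0.
have wW := integral_sqr_step h (- (1 / 4)) lower_omega h0.
have eK := integral_sqr_corr_step h 0 lower_eta h_gt0 ra.
have T0 : 0 <= rN lower_T * h by rewrite mulr_ge0 // rN_ge0.
have ewT t : `|t| <= 1 / 4 -> ((rN lower_T * h)%:E <= corr e w t)%E.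
  move=> /quarter_window; apply: (corr_step_ge _ _ _ _ _ _ 240 _ h0 ra); first by vm_compute.
  by vm_compute.
have b0 : 0 <= rN lower_b * h ^+ 2 by rewrite mulr_ge0 ?rN_ge0 // exprn_ge0.
have th0 : 0 < rN lower_t * h ^+ 2 by rewrite mulr_gt0 ?exprn_gt0 ?h_gt0 // rN_gt0.
have lam0 : 0 < rN lower_l / rN lower_d :> R by rewrite divr_gt0 // rN_gt0.
have := energy_bound k e w mk me mw k0 e0 w0 _ k_supp _ _ _ _ M convo_le eA T0 ewT wW eK
  _ _ _ lam0 th0 b0.
rewrite -f1 => /(_ k1); apply: lower_bound_arith.
by vm_compute.
Qed.

End main_bounds.

(** * The upper bound 1.5098 *)

Section upper_certificate.
Import BinNat.

Definition upper_certificate (H C A : N) : bool :=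
  (N.leb 1 A && N.leb (10000 * (H * C)) (15098 * (A * A)))%N.

End upper_certificate.

Section upper_bound.
Context {R : realType}.
Local Notation mu := (@lebesgue_measure R).
Local Notation cmu := (@completed_lebesgue_measure R).
Local Notation h := ((rN grid)^-1 : R).

(** Mass [A / H] and peak at most [C / H] give, after normalisation, the ratio [H C / A^2]. *)
Lemma upper_bound_arith (H C A : N) (k := (rN H : R)^-1) : 0 < rN H :> R ->
  upper_certificate H C A ->
  ((rN A * k)^-1 * (rN A * k)^-1) * (rN C * k) <= 15098 / 10000.
Proof.
move=> H0 /andP[/(rN_gt0 (R := R)) A0 /(ler_rN (R := R))].
rewrite !(rNM, rN_literals) {}/k.
move: (rN H) (rN A) (rN C) H0 A0 => {}H {}A {}C H0 A0 cert.
have -> : (A / H)^-1 * (A / H)^-1 * (C / H) = H * C / (A * A).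
  by field; rewrite !gt_eqF.
rewrite ler_pdivrMr ?mulr_gt0 // mulrAC ler_pdivlMr ?ltr0n //.
by rewrite mulrC.
Qed.

Lemma step_supp (k p x : R) l : 0 <= k -> step k p l x != 0 ->
  p <= x <= p + (size l)%:R * k.
Proof.
move=> k0; apply: contraNT => xp; apply/eqP.
rewrite /step -[RHS](mulr0 (rN (lN l))) -lsum_const; apply: eq_in_lsum => i il.
rewrite indicE; case: (boolP (x \in _)) => // /set_mem; rewrite /cell /= in_itv /= => /andP[h1 h2].
case/negP: xp; have i0 : 0 <= i%:R * k by rewrite mulr_ge0.
have : i.+1%:R * k <= (size l)%:R * k by rewrite ler_wpM2r // ler_nat.
rewrite -natr1 mulrDl mul1r => ilk; apply/andP; split; lra.
Qed.

Definition near_optimal (x : R) : R :=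
  (rN (lN upper_steps) * h)^-1 * step h (- (1 / 4)) upper_steps x.

Lemma mass_gt0 : 0 < rN (lN upper_steps) * h :> R.
Proof. by rewrite mulr_gt0 ?h_gt0 // rN_gt0 //; vm_compute. Qed.

Lemma measurable_near_optimal : measurable_fun [set: R] near_optimal.
Proof. by apply: measurable_funM => //; exact: measurable_step. Qed.

Lemma near_optimal_ge0 x : 0 <= near_optimal x.
Proof. by rewrite mulr_ge0 ?step_ge0 // invr_ge0 ltW // mass_gt0. Qed.

Lemma near_optimal_admissible : @admissible R near_optimal.
Proof.
have h0 : 0 <= h by exact: ltW h_gt0.
split.
- by apply: measurable_fun_borel_lebesgue; exact: measurable_near_optimal.
- exact: near_optimal_ge0.
- move=> x /=; rewrite mulf_eq0 negb_or => /andP[_ /(step_supp _ _ _ _ h0)].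
  have -> : size upper_steps = 240%N by vm_compute.
  by rewrite half_grid in_itv /= => /andP[? ?]; apply/andP; split; lra.
- rewrite integral_completed; first last.
  + by move=> x; rewrite lee_fin near_optimal_ge0.
  + by apply/measurable_EFinP; exact: measurable_near_optimal.
  under eq_integral do rewrite EFinM.
  rewrite ge0_integralZl //.
  + by rewrite integral_step // -EFinM mulVf // gt_eqF // mass_gt0.
  + by apply/measurable_EFinP; exact: measurable_step.
  + by move=> x _; rewrite lee_fin step_ge0.
  + by rewrite lee_fin invr_ge0 ltW // mass_gt0.
Qed.

Lemma sup_autoconv_near_optimal_le :
  (sup_autoconv near_optimal <= (15098 / 10000)%:E)%E.
Proof.
have h0 : 0 <= h by exact: ltW h_gt0.
pose s : R -> \bar R := EFin \o step h (- (1 / 4)) upper_steps.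
pose c : R := (rN (lN upper_steps) * h)^-1.
have c0 : 0 <= c by rewrite invr_ge0 ltW // mass_gt0.
have ms : measurable_fun [set: R] s by apply/measurable_EFinP; exact: measurable_step.
have s0 x : (0 <= s x)%E by rewrite lee_fin step_ge0.
have gE x t : (near_optimal t * near_optimal (x - t))%:E = ((c * c)%:E * (s t * s (x - t)%R))%E.
  by rewrite /near_optimal -!EFinM; congr EFin; rewrite mulrACA.
have mss x : measurable_fun [set: R] (fun t => s t * s (x - t)%R)%E.
  by apply: emeasurable_funM => //; exact: measurable_comp_sub.
apply: ge_ereal_sup => _ [x _ <-]; rewrite /autoconv.
under eq_integral do rewrite gE.
rewrite integral_completed; first last.
- by move=> t; rewrite !mule_ge0 // lee_fin mulr_ge0.
- exact: measurable_funeM.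
rewrite ge0_integralZl //; first last.
- by rewrite lee_fin mulr_ge0.
- by move=> t _; rewrite mule_ge0.
- exact: mss.
have cert : all (fun a => BinNat.N.leb a upper_C) (lmul upper_steps upper_steps).
  by vm_compute.
have := convo_step_le h (- (1 / 4)) upper_steps upper_C x h0 cert.
have cc0 : (0 <= (c * c)%:E)%E by rewrite lee_fin; exact: (mulr_ge0 c0 c0).
move=> /(lee_wpmul2l cc0); rewrite -EFinM => /le_trans; apply.
by rewrite lee_fin; apply: upper_bound_arith; [exact: grid_gt0|vm_compute].
Qed.

End upper_bound.

Theorem mainTheorem2 (R : realType) :
  ((12748 / 10000)%:E <= inf_sup_autoconv R <= (15098 / 10000)%:E)%E.
Proof.
apply/andP; split.
- by apply: le_ereal_inf_tmp => _ [f fA <-]; exact: sup_autoconv_ge.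
- apply: le_trans sup_autoconv_near_optimal_le.
  apply: ereal_inf_lbound; exists near_optimal; last by [].
  exact: near_optimal_admissible.
Qed.
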